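(* Assume $R^u>R^{\dagger}$ and $q^\dagger<q_{\mathrm{ad}}<q^u$. Then $x^s=(R^s,q^s)$ is a locally asymptotically stable fixed point of the modified system $$\dot R = K_R - f(p(q))R-\alpha_{\mathrm{ad}}(R,q),\qquad \dot q=\alpha_{\mathrm{ad}}(R,q)-\mu(q),$$ and for every initial condition $x=(R,q)\in X_{\mathrm{ad}}:=[0,\infty)\times[0,q_{\mathrm{ad}}]$ the trajectory $\varphi(t;x)$ of this modified system satisfies $$\lim_{t\to\infty}\varphi(t;x)=x^s .$$
   Context: Write $\mathbb{R}_+=[0,\infty)$. Fix constants $K_R,\mu^*,q_c,\beta,q_m,q_{\max}>0$ with $K_R>\mu^*$ and $q_{\max}\ge 2q_m$. Price function $p:\mathbb{R}_+\to\mathbb{R}_+$: $p(q)=\beta q$ for $0\le q\le q_m$, $p(q)=\beta(2q_m-q)$ for $q_m\le q\le 2q_m$, $p(q)=0$ for $q>2q_m$. Service rate $\mu:\mathbb{R}_+\to\mathbb{R}_+$: $\mu(q)=\frac{\mu^*}{q_c}q$ for $0\le q\le q_c$, $\mu(q)=\mu^*$ for $q\ge q_c$. Sensitivity function $f:\mathbb{R}_+\to\mathbb{R}_+$: continuously differentiable with strictly positive derivative. Set $\eta_1(q)=\frac{\mu(q)}{\alpha(q)}$ (for $q\in[0,q_{\max})$) and $\eta_2(q)=\frac{K_R}{\alpha(q)+f(p(q))}$. Admission rate $\alpha:\mathbb{R}_+\to[0,\infty)$: continuously differentiable and such that (i) $\alpha$ is positive and strictly decreasing on $[0,q_{\max})$;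 (ii) $\alpha(q)=0$ for $q\ge q_{\max}$; (iii) there are exactly two points $q^s,q^u$ in $(0,q_{\max})$ solving $\eta_1(q)=\eta_2(q)$; moreover $q^s\in(0,q_m)$, $q^u\in(q_m,2q_m)$, $\eta_1'(q^u)<\eta_2'(q^u)$, and $\mu(q^s)=\mu(q^u)=\mu^*$. Put $R^s=\eta_1(q^s)$, $R^u=\eta_1(q^u)$, $R^\dagger:=\max\{\eta_2(q): q\in[0,q_m]\}$, and $q^\dagger:=\eta_1^{-1}(R^\dagger)$, where $\eta_1:[0,q_{\max})\to[0,\infty)$ is a strictly increasing bijection. For a given admittance bound $q_{\mathrm{ad}}$ define $\alpha_{\mathrm{ad}}(R,q)=\alpha(q)R$ if $0\le q<q_{\mathrm{ad}}$ and $\alpha_{\mathrm{ad}}(R,q)=\min\{\alpha(q)R,\mu^*\}$ if $q\ge q_{\mathrm{ad}}$. The right-hand side of the modified system is discontinuous; solutions are understood in the Carathéodory sense (absolutely continuous functions satisfying the equation almost everywhere). For initial conditions in $X_{\mathrm{ad}}$ such solutions are unique in forward time and exist on $[0,\infty)$; $\varphi(\cdot;x)$ denotes this solution. *)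

(* Defs.v *)
From HB Require Import structures.
From mathcomp Require Import all_boot all_order all_algebra.
From mathcomp Require Import all_classical all_reals all_analysis.

Set Implicit Arguments.
Unset Strict Implicit.
Unset Printing Implicit Defensive.

Import Order.TTheory GRing.Theory Num.Theory.
Import numFieldNormedType.Exports.

Local Open Scope classical_set_scope.
Local Open Scope ring_scope.

(* Functions on [0, +oo) are represented by functions R -> R of which only the
   restriction to [0, +oo) matters. *)

Section calculus.
Context {R : realType}.

(* [df] is the derivative of [f] on [0, +oo); it is one-sided at 0 since the
   difference quotient is restricted to nonnegative arguments. *)
Definition derivative_Rplus (f df : R -> R) : Prop :=
  forall x : R, 0 <= x ->
    (f y - f x) / (y - x) @[y --> within `[0, +oo[ x^'] --> df x.

Definition C1_Rplus (f df : R -> R) : Prop :=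
  derivative_Rplus f df /\ {within `[0, +oo[, continuous df}.

Definition abs_continuous (V : normedModType R) (a b : R) (g : R -> V) : Prop :=
  forall e : R, 0 < e -> exists2 d : R, 0 < d &
    forall (n : nat) (u v : 'I_n -> R),
      (forall i, [/\ a <= u i, u i <= v i & v i <= b]) ->
      trivIset [set: 'I_n] (fun i => `]u i, v i[%classic) ->
      \sum_(i < n) (v i - u i) < d ->
      \sum_(i < n) `|g (v i) - g (u i)| < e.

End calculus.

Section dynamics.
Context {R : realType} (V : normedModType R).

(* Forward Caratheodory solutions of x' = F x on [0, +oo), where F is only
   meaningful on the domain [D]; absolute continuity is local, i.e., on every
   compact interval [0, T]. *)
Definition caratheodory_solution (D : set V) (F : V -> V) (phi : R -> V)
    : Prop :=
  [/\ forall t : R, 0 <= t -> D (phi t),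
      forall T : R, 0 <= T -> abs_continuous 0 T phi &
      {ae lebesgue_measure, forall t : R, 0 < t ->
         is_derive t 1 phi (F (phi t))}].

Definition fixed_point (D : set V) (F : V -> V) (x : V) : Prop :=
  D x /\ F x = 0.

Definition lyapunov_stable (D : set V) (F : V -> V) (x : V) : Prop :=
  forall e : R, 0 < e -> exists2 d : R, 0 < d &
    forall phi : R -> V, caratheodory_solution D F phi ->
      `|phi 0 - x| < d -> forall t : R, 0 <= t -> `|phi t - x| < e.

Definition locally_attractive (D : set V) (F : V -> V) (x : V) : Prop :=
  exists2 d : R, 0 < d &
    forall phi : R -> V, caratheodory_solution D F phi ->
      `|phi 0 - x| < d -> phi t @[t --> +oo] --> x.

Definition locally_asymptotically_stable_fixed_point
    (D : set V) (F : V -> V) (x : V) : Prop :=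
  [/\ fixed_point D F x, lyapunov_stable D F x & locally_attractive D F x].

End dynamics.

Section model.
Context {R : realType}.

Definition price (beta qm q : R) : R :=
  if q <= qm then beta * q
  else if q <= 2 * qm then beta * (2 * qm - q)
  else 0.

Definition service (mus qc q : R) : R :=
  if q <= qc then mus / qc * q else mus.

Definition eta1 (mu alpha : R -> R) (q : R) : R := mu q / alpha q.

Definition eta2 (KR : R) (f p alpha : R -> R) (q : R) : R :=
  KR / (alpha q + f (p q)).

Definition alpha_ad (mus qad : R) (alpha : R -> R) (r q : R) : R :=
  if q < qad then alpha q * r else Num.min (alpha q * r) mus.

Definition modified_field (KR mus qad : R) (f p mu alpha : R -> R)
    (x : R * R) : R * R :=
  let: (r, q) := x in
  (KR - f (p q) * r - alpha_ad mus qad alpha r q,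
   alpha_ad mus qad alpha r q - mu q).

(* The coefficients of the field constrain only the second coordinate. *)
Definition field_domain : set (R * R) := [set x | 0 <= x.2].

Definition X_ad (qad : R) : set (R * R) :=
  [set x | 0 <= x.1 /\ 0 <= x.2 <= qad].

End model.

(* Main.v *)
Require Import Defs.
From HB Require Import structures.
From mathcomp Require Import all_boot all_order all_algebra.
From mathcomp Require Import all_classical all_reals all_analysis.
From mathcomp Require Import measurable_realfun ring lra.
Import Order.TTheory GRing.Theory Num.Theory.
Import numFieldNormedType.Exports.
Local Open Scope classical_set_scope.
Local Open Scope ring_scope.

(** Put v = R - eta1(q) and h = ((f(p(q)) + alpha) eta1 - KR) / alpha, which has
    the sign of eta1 - eta2.  In these terms the modified system is a damped
    oscillator
      q' = alpha w,   R' = - alpha h - f(p(q)) v - alpha w,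
    where w = v, except that w = 0 while the trajectory slides along q = qad,
    which only happens when v > 0 and h > 0.  On [0, qad] the function
    eta1 - eta2 changes sign only at qs, so a primitive W of h is minimal at qs,
    and the energy E = v^2/2 + W(q) is nonincreasing, with E' <= - c v^2.
    Moreover, as long as E >= d > 0, the function R (q - qs) + C E decreases at
    a uniform rate for C large, although it is bounded below; hence E tends
    to 0.

    E is not differentiable along solutions, because the service rate has a
    corner, so its monotonicity is derived from upper bounds on difference
    quotients at almost every time. *)

(** * Absolutely continuous functions with nonpositive slopes *)

(** Formally v' = - alpha h - f(p(q)) v - (1 + eta1') alpha w, hence E' = - alpha h (v - w) -
    f(p(q)) v^2 - (1 + eta1') alpha v w. Since eta1 is nondecreasing, the term in eta1' can only
    help, so no derivative of eta1 enters the energy estimate. During sliding - alpha h v - f(p(q))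
    v^2 remains, which is dissipative because h(qad) > 0; this is where qad must lie strictly
    between qs and qu. The bound q^dagger < qad yields qs < qad through qs <= q^dagger, and qad < qu
    keeps the second zero of eta1 - eta2 out of [0, qad]. The obstacle is that the dissipation
    vanishes at v = 0 even away from the equilibrium, so E alone has no decay rate, and an
    invariance argument would have to pass to limits of solutions of a discontinuous system. The
    cross term R (q - qs) avoids this: its derivative contains - alpha h (q - qs), negative wherever
    q differs from qs, while its other terms are O(|v|) and are controlled by a large multiple of
    the dissipation - v^2. *)

Lemma ae_lebesgueS {R : realType} (P Q : R -> Prop) :
  (forall t, P t -> Q t) -> {ae lebesgue_measure, forall t : R, P t} ->
  {ae lebesgue_measure, forall t : R, Q t}.
Proof.
move=> PQ [N [mN N0 sub]]; exists N; split => //.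
by apply: subset_trans sub => t /= nQ /PQ.
Qed.

Lemma open_cover_negligible {R : realType} (N : set R) (d : R) :
  (@lebesgue_measure R).-negligible N -> 0 < d ->
  exists U : set R,
    [/\ open U, N `<=` U & (lebesgue_measure U < d%:E)%E].
Proof.
move=> [B [mB B0 NB]] d0.
have B_lt : (lebesgue_measure B < +oo)%E by rewrite [X in (X < _)%E]B0 ltry.
have [U [oU BU Ud]] := lebesgue_regularity_outer mB B_lt d0.
exists U; split => //; first exact: subset_trans BU.
rewrite -(setDUK BU) measureU//.
- by rewrite [X in (X + _ < _)%E]B0 add0e.
- by apply: measurableD => //; exact: open_measurable.
- by apply/seteqP; split => // x [? []].
Qed.

(** Converts the small measure of an open cover into the small total length that absolute continuity
    asks for. *)
Lemma sum_itv_length_le {R : realType} (U : set R) (n : nat)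
    (u v : 'I_n -> R) :
  measurable U -> (forall i, u i <= v i) ->
  (forall i, `]u i, v i[ `<=` U) ->
  trivIset [set: 'I_n] (fun i => `]u i, v i[%classic) ->
  ((\sum_(i < n) (v i - u i))%:E <= lebesgue_measure U)%E.
Proof.
move=> mU uv sub triv.
have -> : ((\sum_(i < n) (v i - u i))%:E =
    \sum_(i < n) lebesgue_measure `]u i, v i[%classic)%E.
  rewrite -sumEFin; apply: eq_bigr => i _.
  rewrite lebesgue_measure_itv/= lte_fin.
  case: ltP => [//|vu].
  have -> : u i = v i by apply/le_anti; rewrite uv vu.
  by rewrite subrr.
rewrite -measure_semi_additive_ord //; last first.
  by apply: bigsetU_measurable => i _; exact: measurable_itv.
apply: le_measure; rewrite ?inE //.
  by apply: bigsetU_measurable => i _; exact: measurable_itv.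
by apply: (big_ind (fun X => X `<=` U)) => // X Y XU YU; rewrite subUset.
Qed.

(** * Permanence properties of absolute continuity *)

Section abs_continuous_theory.
Context {R : realType}.
Implicit Types (a b C : R).

(** Two dominating functions are allowed so that a single estimate serves Lipschitz images, sums and
    products. *)
Lemma abs_continuous_le {V1 V2 V3 : normedModType R} a b C
    (u : R -> V1) (v : R -> V2) (g : R -> V3) :
  abs_continuous a b u -> abs_continuous a b v ->
  (forall x y, a <= x -> x <= y -> y <= b ->
     `|g y - g x| <= C * (`|u y - u x| + `|v y - v x|)) ->
  abs_continuous a b g.
Proof.
move=> acu acv dom e e0.
have C1 : 0 < `|C| + 1 by rewrite ltr_wpDl.
have e'0 : 0 < e / (2 * (`|C| + 1)) by rewrite divr_gt0// mulr_gt0.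
have [d1 d10 hd1] := acu _ e'0; have [d2 d20 hd2] := acv _ e'0.
exists (Num.min d1 d2); first by rewrite lt_min d10.
move=> n x y xy triv; rewrite lt_min => /andP[s1 s2].
have := hd1 n x y xy triv s1; have := hd2 n x y xy triv s2.
set E := e / _ => se2 se1.
have -> : e = (`|C| + 1) * (E + E) by rewrite /E; field; lra.
apply: le_lt_trans (_ : _ <= (`|C| + 1) *
  (\sum_(i < n) `|u (y i) - u (x i)| + \sum_(i < n) `|v (y i) - v (x i)|)) _.
  rewrite -big_split/= mulr_sumr; apply: ler_sum => i _.
  have [ax xyi yb] := xy i.
  apply: le_trans (dom _ _ ax xyi yb) _.
  apply: ler_wpM2r; first by rewrite addr_ge0.
  by have := ler_norm C; lra.
by rewrite ltr_pM2l// ltrD.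
Qed.

Lemma abs_continuousS {V : normedModType R} a b a' b' (u : R -> V) :
  a <= a' -> b' <= b -> abs_continuous a b u -> abs_continuous a' b' u.
Proof.
move=> aa bb acu e e0; have [d d0 hd] := acu e e0; exists d => // n x y xy.
by apply: hd => i; have [? ? ?] := xy i; split => //;
  [exact: le_trans aa _|exact: le_trans bb].
Qed.

Lemma abs_continuous_id a b : abs_continuous a b (id : R -> R).
Proof.
move=> e e0; exists e => // n u v uv _; apply: le_lt_trans.
by apply: ler_sum => i _; have [_ ? _] := uv i; rewrite ger0_norm// subr_ge0.
Qed.

Lemma abs_continuous_lipschitz {V1 V2 : normedModType R} a b C
    (u : R -> V1) (g : R -> V2) :
  abs_continuous a b u ->
  (forall x y, a <= x -> x <= y -> y <= b ->
     `|g y - g x| <= C * `|u y - u x|) ->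
  abs_continuous a b g.
Proof.
move=> acu dom; apply: (@abs_continuous_le _ _ _ a b (C / 2) u u) => //.
by move=> x y ax xy yb; have := dom _ _ ax xy yb; lra.
Qed.

Lemma abs_continuousD a b (u v : R -> R) :
  abs_continuous a b u -> abs_continuous a b v ->
  abs_continuous a b (fun t => u t + v t).
Proof.
move=> acu acv; apply: (abs_continuous_le a b 1 u v) => // x y _ _ _.
by rewrite mul1r opprD addrACA ler_normD.
Qed.

Lemma abs_continuousZ a b C (u : R -> R) :
  abs_continuous a b u -> abs_continuous a b (fun t => C * u t).
Proof.
move=> acu; apply: (abs_continuous_lipschitz a b `|C| u) => // x y _ _ _.
by rewrite -mulrBr normrM.
Qed.

Lemma abs_continuous_within {V : normedModType R} a b (u : R -> V) :
  abs_continuous a b u -> {within `[a, b], continuous u}.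
Proof.
move=> acu; apply/subspace_continuousP => x /=.
rewrite in_itv/= => /andP[ax xb].
apply/cvgrPdist_lt => e e0; have [d d0 hd] := acu _ e0.
have step y z : a <= y -> y <= z -> z <= b -> z - y < d -> `|u z - u y| < e.
  move=> ay yz zb yzd.
  have := hd 1%N (fun=> y) (fun=> z); rewrite !big_ord1; apply => //.
  by move=> i j _ _ _; rewrite !ord1.
rewrite near_withinE; exists d => //= y; rewrite /ball/= => xyd.
rewrite in_itv/= => /andP[ay yb].
move: xyd; rewrite ltr_norml => /andP[? ?].
have [xy|yx] := leP x y; last by apply: step => //; lra.
by rewrite distrC; apply: step => //; lra.
Qed.

Lemma abs_continuous_bounded a b (u : R -> R) : a <= b ->
  abs_continuous a b u ->
  exists2 M, 0 < M & forall t, a <= t -> t <= b -> `|u t| <= M.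
Proof.
move=> ab acu.
have acn : abs_continuous a b (fun t => `|u t|).
  apply: (abs_continuous_lipschitz a b 1 u) => // x y _ _ _.
  by rewrite mul1r ler_dist_dist.
have [c _ hc] := EVT_max ab (abs_continuous_within _ _ _ acn).
exists (`|u c| + 1); first by rewrite ltr_wpDl.
move=> t at_ tb; apply: le_trans (hc t _) _; first by rewrite in_itv/= at_.
by rewrite lerDl.
Qed.

Lemma abs_continuousM a b (u v : R -> R) : a <= b ->
  abs_continuous a b u -> abs_continuous a b v ->
  abs_continuous a b (fun t => u t * v t).
Proof.
move=> ab acu acv.
have [M M0 hM] := abs_continuous_bounded _ _ _ ab acu.
have [N N0 hN] := abs_continuous_bounded _ _ _ ab acv.
apply: (abs_continuous_le a b (M + N) u v) => // x y ax xy yb.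
have -> : u y * v y - u x * v x = (u y - u x) * v y + u x * (v y - v x) by ring.
apply: le_trans (ler_normD _ _) _; rewrite !normrM.
have := hM x ax (le_trans xy yb); have := hN y (le_trans ax xy) yb => vy ux.
have := ler_wpM2l (normr_ge0 (u y - u x)) vy.
have := ler_wpM2r (normr_ge0 (v y - v x)) ux.
have := mulr_ge0 (ltW M0) (normr_ge0 (u y - u x)).
have := mulr_ge0 (ltW N0) (normr_ge0 (v y - v x)).
lra.
Qed.

End abs_continuous_theory.

(* [k] bounds from above all limits of the difference quotient of [g] at [t];
   multiplying by [(y - t) ^+ 2] treats both sides of [t] at once. *)
Definition upper_slope {R : realType} (g : R -> R) (t k : R) : Prop :=
  forall e : R, 0 < e ->
    \forall y \near t, (g y - g t) * (y - t) <= (k + e) * (y - t) ^+ 2.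

Definition slope {R : realType} (g : R -> R) (t k : R) : Prop :=
  forall e : R, 0 < e ->
    \forall y \near t, `|g y - g t - k * (y - t)| <= e * `|y - t|.

Section interval_family.
Context {R : realType} (U : set R) (a : R) (g : R -> R).

Definition interval_family (x : R) {n : nat} (u v : 'I_n -> R) : Prop :=
  (forall i, [/\ a <= u i, u i <= v i, v i <= x & `]u i, v i[ `<=` U]) /\
  trivIset [set: 'I_n] (fun i => `]u i, v i[%classic).

(* The sum absorbs the increments of [g] over the intervals that cover the
   exceptional null set, where nothing is known about the slope. *)
Definition variation_bound (e x : R) : Prop :=
  exists n (u v : 'I_n -> R), interval_family x u v /\
    g x - g a <= e * (x - a) + \sum_(i < n) `|g (v i) - g (u i)|.

Lemma variation_bound_slope (e x y : R) : x <= y ->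
  g y - g x <= e * (y - x) -> variation_bound e x -> variation_bound e y.
Proof.
move=> xy gxy [n [u [v [[fam triv] le]]]]; exists n, u, v; split.
  by split => // i; have [? ? ? ?] := fam i; split => //; exact: le_trans xy.
by move: le; set S := \sum_(_ < _) _; lra.
Qed.

(** The interval []x, y[] joins the family at index [ord0]. It is disjoint from the others because
    they all end at or before [x], and its own increment of [g] is absorbed by the sum. *)
Lemma variation_bound_open (e x y : R) : 0 <= e -> a <= x -> x <= y ->
  `]x, y[ `<=` U -> variation_bound e x -> variation_bound e y.
Proof.
move=> e0 ax xy xyU [n [u [v [[fam triv] le]]]].
pose u' (i : 'I_n.+1) := if unlift ord0 i is Some j then u j else x.
pose v' (i : 'I_n.+1) := if unlift ord0 i is Some j then v j else y.
have S' (F : 'I_n.+1 -> Prop) : F ord0 -> (forall j, F (lift ord0 j)) ->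
    forall i, F i.
  by move=> F0 Fl i; case: (unliftP ord0 i) => [j ->|->].
exists n.+1, u', v'; split; last first.
  rewrite big_ord_recl {1 2}/u' {1 2}/v' unlift_none.
  under eq_bigr do rewrite /u' /v' liftK.
  have yx0 : 0 <= y - x by rewrite subr_ge0.
  move: le (mulr_ge0 e0 yx0) (ler_norm (g y - g x)).
  by set S := \sum_(_ < _) _; lra.
split.
  apply: (S') => [|j]; rewrite /u' /v' ?unlift_none ?liftK//.
  by have [? ? ? ?] := fam j; split => //; exact: le_trans xy.
have disj j z : `]u j, v j[%classic z -> `]x, y[%classic z -> False.
  have [_ _ vx _] := fam j; rewrite /= !in_itv/= => /andP[_ zv] /andP[xz _].
  by move: (lt_trans xz zv); rewrite ltNge vx.
apply: (S') => [|i]; apply: (S') => [|j]; rewrite /u' /v' ?unlift_none ?liftK//.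
- by move=> _ _ [z [zx zj]]; have := disj _ _ zj zx.
- by move=> _ _ [z [zi zx]]; have := disj _ _ zi zx.
- by move=> _ _ /(triv i j I I) ->.
Qed.
End interval_family.

(** The exceptional times are covered by an open set [U] too small for [g] to vary by [e / 2] over
    disjoint intervals inside it. Outside [U] the slope bound costs at most [c] per unit of time, so
    the total growth from [a] to [b] stays below [e]. *)
Lemma upper_slope_nonincreasing {R : realType} (a b : R) (g : R -> R) :
  a <= b -> abs_continuous a b g ->
  {ae lebesgue_measure, forall t : R, a < t -> upper_slope g t 0} ->
  g b <= g a.
Proof.
move=> ab acg aeg; apply/ler_addgt0Pr => e e0.
have [d d0 hd] := acg _ (divr_gt0 e0 (ltr0n _ 2)).
(* The point [a] is added because the slope hypothesis speaks only of times after [a]. *)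
pose N := [set t : R | ~ (a < t -> upper_slope g t 0)] `|` [set a].
have Nneg : (@lebesgue_measure R).-negligible N.
  apply: negligibleU => //; exists [set a]; split => //.
  exact: lebesgue_measure_set1.
have [U [oU NU Ud]] := open_cover_negligible N d Nneg d0.
have mU : measurable U by exact: open_measurable.
pose c := e / 2 / (b - a + 1).
have ba1 : 0 < b - a + 1 by lra.
have c0 : 0 < c by rewrite !divr_gt0.
suff : variation_bound U a g c b.
  move=> [n [u [v [[fam triv] le]]]].
  have sum_lt : \sum_(i < n) `|g (v i) - g (u i)| < e / 2.
    apply: hd => // [i|]; first by have [? ? ? ?] := fam i.
    rewrite -lte_fin; apply: le_lt_trans Ud.
    by apply: sum_itv_length_le => // i; have [] := fam i.
  have : c * (b - a) <= e / 2.
    rewrite /c -mulrA ger_pMr; last by rewrite divr_gt0.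
    by rewrite mulrC ler_pdivrMr//; lra.
  by move: le sum_lt; set S := \sum_(_ < _) _; lra.
(* The propagation starts from some [y] to the left of [x], because the supremum to which it is
   applied is not yet known to belong to [S]. If [x] lies in [U], an interval is added; otherwise
   the slope estimates on both sides of [x] are joined. *)
have local x : a <= x -> exists2 r : R, 0 < r &
    forall y z, a <= y -> x - r < y -> y <= x -> x <= z -> z < x + r ->
      variation_bound U a g c y -> variation_bound U a g c z.
  move=> ax; have [xU|xNU] := pselect (U x).
    have [r /= r0 hr] : nbhs x U by exact: open_nbhs_nbhs.
    exists r => // y z ay xry yx xz zxr; apply: variation_bound_open => //.
    - exact: ltW.
    - exact: le_trans xz.
    - move=> w /=; rewrite in_itv/= => /andP[yw wz]; apply: hr => /=.
      by rewrite ltr_norml; lra.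
  have /(_ _ c0)[r /= r0 hr] : upper_slope g x 0.
    apply: contrapT => nx; apply: xNU; apply: NU.
    have [->|xa] := eqVneq x a; first by right.
    left => /= h; apply: nx; apply: h.
    by rewrite lt_neqAle eq_sym xa.
  exists r => // y z ay xry yx xz zxr; apply: variation_bound_slope.
    exact: le_trans xz.
  have slope_x w : `|x - w| < r -> (g w - g x) * (w - x) <= c * (w - x) ^+ 2.
    by move=> xw; have := hr w xw; rewrite add0r.
  have G1 : g x - g y <= c * (x - y).
    have [->|xy] := eqVneq y x; first by rewrite !subrr mulr0.
    have yx0 : 0 < x - y by rewrite subr_gt0 lt_neqAle xy.
    by rewrite -(ler_pM2r yx0); have := slope_x y; rewrite ltr_norml; lra.
  have G2 : g z - g x <= c * (z - x).
    have [->|zx] := eqVneq z x; first by rewrite !subrr mulr0.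
    have zx0 : 0 < z - x by rewrite subr_gt0 lt_neqAle eq_sym zx.
    by rewrite -(ler_pM2r zx0); have := slope_x z; rewrite ltr_norml; lra.
  lra.
(* Real induction: the bound propagates to the right from [a] up to [b]. *)
pose S := [set x | a <= x <= b /\ variation_bound U a g c x].
have Sa : S a.
  split; first by rewrite lexx.
  exists 0, (fun=> 0), (fun=> 0); split; first by split => [[]//|[]].
  by rewrite big_ord0 !subrr mulr0 addr0.
have hS : has_sup S by split; [exists a|exists b => x [/andP[]]].
have a_sup : a <= sup S by apply: ub_le_sup => //; case: hS.
have sup_b : sup S <= b by apply: ge_sup; [exists a|move=> x [/andP[]]].
have [r r0 hr] := local _ a_sup.
have [y [/andP[ay yb] vy] hy] := sup_adherent r0 hS.
have y_sup : y <= sup S.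
  by apply: ub_le_sup; [case: hS|split => //; rewrite ay yb].
pose z := Num.min b (sup S + r / 2).
have z_sup : sup S <= z by rewrite le_min sup_b; lra.
have vz : variation_bound U a g c z.
  by apply: (hr y) => //; rewrite gt_min; apply/orP; right; lra.
have : z <= sup S.
  apply: ub_le_sup; [by case: hS|split => //].
  by rewrite (le_trans a_sup z_sup) ge_min lexx.
rewrite ge_min => /orP[bS|]; last by lra.
by rewrite (le_anti (_ : b <= z <= b)) // ?ge_min ?lexx ?(le_trans bS).
Qed.
(** * Calculus of slopes *)

Section slope_theory.
Context {R : realType}.
Implicit Types (u v : R -> R) (t k : R).

Lemma is_derive_slope u t k : is_derive t 1 u k -> slope u t k.
Proof.
move=> [du <-] e e0.
have /cvgrPdist_le /(_ _ e0)[r /= r0 hr] := du.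
exists r => //= y /=; have [->|yt] := eqVneq y t.
  by rewrite !subrr mulr0 subr0 normr0 mulr0.
move=> tyr; have yt0 : y - t != 0 by rewrite subr_eq0.
have := hr (y - t); rewrite /= sub0r normrN distrC => /(_ tyr yt0).
rewrite -[(y - t) *: 1]/((y - t) * 1) mulr1 subrK.
rewrite -[_ *: _]/(_ * _) -/('D_1 u t) => le_e.
rewrite [in leRHS]distrC.
have -> : u y - u t - 'D_1 u t * (y - t) =
    - ('D_1 u t - (y - t)^-1 * (u y - u t)) * (y - t) by field.
by rewrite normrM normrN ler_wpM2r.
Qed.

Lemma is_derive_pair_slope (phi : R -> R * R) t (k : R * R) :
  is_derive t 1 phi k ->
  slope (fun s => (phi s).1) t k.1 /\ slope (fun s => (phi s).2) t k.2.
Proof.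
move=> [du <-].
have d1 : (fun h => h^-1 * ((phi (h * 1 + t)).1 - (phi t).1)) @ 0^' -->
    ('D_1 phi t).1 by exact: (cvg_comp _ _ du cvg_fst).
have d2 : (fun h => h^-1 * ((phi (h * 1 + t)).2 - (phi t).2)) @ 0^' -->
    ('D_1 phi t).2 by exact: (cvg_comp _ _ du cvg_snd).
by split; apply: is_derive_slope; split;
  [apply/cvg_ex; eexists; exact: d1|exact: cvg_lim d1
  |apply/cvg_ex; eexists; exact: d2|exact: cvg_lim d2].
Qed.

Lemma slope_lipschitz u t k : slope u t k ->
  \forall y \near t, `|u y - u t| <= (`|k| + 1) * `|y - t|.
Proof.
move=> /(_ 1 ltr01); apply: filterS => y; rewrite mul1r => h.
have -> : u y - u t = (u y - u t - k * (y - t)) + k * (y - t) by ring.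
by apply: le_trans (ler_normD _ _) _; rewrite normrM; lra.
Qed.

Lemma slope_upper u t k : slope u t k -> upper_slope u t k.
Proof.
move=> su e e0; have := su e e0; apply: filterS => y h.
have -> : (u y - u t) * (y - t) =
  (u y - u t - k * (y - t)) * (y - t) + k * (y - t) ^+ 2 by ring.
suff : (u y - u t - k * (y - t)) * (y - t) <= e * (y - t) ^+ 2 by lra.
apply: le_trans (ler_norm _) _.
by rewrite normrM -(real_normK (num_real (y - t))) expr2 mulrA ler_wpM2r.
Qed.

Lemma slopeD u v t k l : slope u t k -> slope v t l ->
  slope (fun y => u y + v y) t (k + l).
Proof.
move=> su sv e e0; have e2 : 0 < e / 2 by lra.
apply: filterS2 (su _ e2) (sv _ e2) => y h1 h2.
have -> : u y + v y - (u t + v t) - (k + l) * (y - t) =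
  (u y - u t - k * (y - t)) + (v y - v t - l * (y - t)) by ring.
by apply: le_trans (ler_normD _ _) _; lra.
Qed.

Lemma slopeZ c u t k : slope u t k -> slope (fun y => c * u y) t (c * k).
Proof.
move=> su e e0.
have c1 : 0 < `|c| + 1 by rewrite ltr_wpDl.
have := su _ (divr_gt0 e0 c1); apply: filterS => y h.
have -> : c * u y - c * u t - c * k * (y - t) =
  c * (u y - u t - k * (y - t)) by ring.
rewrite normrM; apply: le_trans (ler_wpM2l (normr_ge0 c) h) _.
rewrite mulrA ler_wpM2r// mulrA ler_pdivrMr// mulrC ler_pM2l//.
by rewrite lerDl.
Qed.

(** The second-order term of a product. Only Lipschitz bounds at [t] are assumed, so that it also
    applies to the square of the increment of [v = r - e q], which need not be differentiable. *)
Lemma slope_increments u v t K L : 0 < K -> 0 < L ->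
  (\forall y \near t, `|u y - u t| <= K * `|y - t|) ->
  (\forall y \near t, `|v y - v t| <= L * `|y - t|) ->
  slope (fun y => (u y - u t) * (v y - v t)) t 0.
Proof.
move=> K0 L0 su sv e e0.
have KLe : 0 < e / (K * L) by rewrite divr_gt0 ?mulr_gt0.
have ty : \forall y \near t, `|y - t| <= e / (K * L).
  by exists (e / (K * L)) => //= y /ltW; rewrite distrC.
apply: filterS3 su sv ty => y hu hv hy.
rewrite !subrr !mul0r !subr0 normrM.
apply: le_trans (ler_pM (normr_ge0 _) (normr_ge0 _) hu hv) _.
rewrite mulrACA mulrA ler_wpM2r//.
by rewrite mulrC -ler_pdivlMr ?mulr_gt0.
Qed.

Lemma slopeM u v t k l : slope u t k -> slope v t l ->
  slope (fun y => u y * v y) t (k * v t + u t * l).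
Proof.
move=> su sv.
have k0 : 0 < `|k| + 1 by rewrite ltr_wpDl.
have l0 : 0 < `|l| + 1 by rewrite ltr_wpDl.
have := slopeD _ _ _ _ _ (slope_increments _ _ _ _ _ k0 l0
  (slope_lipschitz _ _ _ su) (slope_lipschitz _ _ _ sv))
  (slopeD _ _ _ _ _ (slopeZ (v t) _ _ _ su) (slopeZ (u t) _ _ _ sv)).
by move=> s e e0; have := s e e0; apply: filterS => y; congr (`|_| <= _); ring.
Qed.

Lemma slope_comp u v t k l : slope u t k -> slope v (u t) l ->
  slope (v \o u) t (l * k).
Proof.
move=> su sv e e0; have lip := slope_lipschitz _ _ _ su.
set K := `|k| + 1 in lip.
have K0 : 0 < K by rewrite ltr_wpDl.
have l0 : 0 < `|l| + 1 by rewrite ltr_wpDl.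
have Ke : 0 < e / (2 * K) by rewrite divr_gt0 ?mulr_gt0.
have le : 0 < e / (2 * (`|l| + 1)) by rewrite divr_gt0 ?mulr_gt0.
have [r /= r0 hr] := sv _ Ke.
have ty : \forall y \near t, `|y - t| < r / K.
  by exists (r / K) => /= [|y]; [rewrite divr_gt0|rewrite distrC].
apply: filterS3 lip ty (su _ le) => y hu hy hs /=.
have uy : `|u t - u y| < r.
  rewrite distrC; apply: le_lt_trans hu _.
  by rewrite mulrC -ltr_pdivlMr.
have -> : v (u y) - v (u t) - l * k * (y - t) =
  (v (u y) - v (u t) - l * (u y - u t)) + l * (u y - u t - k * (y - t)) by ring.
apply: le_trans (ler_normD _ _) _; rewrite normrM.
have h1 : `|v (u y) - v (u t) - l * (u y - u t)| <= e / 2 * `|y - t|.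
  apply: le_trans (hr _ uy) _.
  have := ler_wpM2l (ltW Ke) hu; congr (_ <= _).
  by field; rewrite gt_eqF.
have h2 : `|l| * `|u y - u t - k * (y - t)| <= e / 2 * `|y - t|.
  apply: le_trans (_ : (`|l| + 1) * `|u y - u t - k * (y - t)| <= _).
    by rewrite ler_wpM2r// lerDl.
  have := ler_wpM2l (ltW l0) hs; congr (_ <= _).
  by field; rewrite gt_eqF.
lra.
Qed.

Lemma upper_slopeD u v t k l : upper_slope u t k -> upper_slope v t l ->
  upper_slope (fun y => u y + v y) t (k + l).
Proof.
move=> su sv e e0; have e2 : 0 < e / 2 by lra.
apply: filterS2 (su _ e2) (sv _ e2) => y; lra.
Qed.

Lemma upper_slopeZ c u t k : 0 <= c -> upper_slope u t k ->
  upper_slope (fun y => c * u y) t (c * k).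
Proof.
rewrite le_eqVlt => /predU1P[<- _ e e0|c0 su e e0].
  apply: filterE => y; rewrite !mul0r subrr mul0r add0r.
  by rewrite mulr_ge0 ?sqr_ge0// ltW.
have := su _ (divr_gt0 e0 c0); apply: filterS => y.
rewrite -(ler_pM2l c0); congr (_ <= _); first by ring.
by field; rewrite gt_eqF.
Qed.

Lemma upper_slope_le u t k l : k <= l -> upper_slope u t k -> upper_slope u t l.
Proof.
move=> kl su e /su; apply: filterS => y h; apply: le_trans h _.
by rewrite ler_wpM2r ?sqr_ge0// lerD2r.
Qed.

Lemma eq_upper_slope u v t k : (forall y, u y - u t = v y - v t) ->
  upper_slope u t k -> upper_slope v t k.
Proof. by move=> uv su e /su; apply: filterS => y; rewrite uv. Qed.

End slope_theory.
(** * Damped oscillators with a sliding line *)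

Lemma cvg_max {R : realType} {T : Type} {F : set_system T} {FF : Filter F}
    (u v : T -> R) (k l : R) :
  u @ F --> k -> v @ F --> l ->
  (fun x => Num.max (u x) (v x)) @ F --> Num.max k l.
Proof.
move=> uk vl; rewrite maxr_absE.
under eq_fun do rewrite maxr_absE.
apply: cvgM; [|exact: cvg_cst]; apply: cvgD; first exact: cvgD.
by apply: cvg_norm; apply: cvgB.
Qed.

Section damped_oscillator.
Context {R : realType} (qs b a0 A G L H eta : R) (a g e h W : R -> R).
Local Notation inb x := (0 <= x <= b).
Implicit Types (x y t w T d : R).
Context (qs_inb : inb qs) (a0_gt0 : 0 < a0) (eta_gt0 : 0 < eta).
Context (a_bound : forall x, inb x -> a0 <= a x <= A).
Context (g_bound : forall x, inb x -> 0 <= g x <= G).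
Context (e_mono : forall x y, inb x -> inb y -> x <= y -> e x <= e y).
Context (e_lip : forall x y, inb x -> inb y -> `|e y - e x| <= L * `|y - x|).
Context (W_lip : forall x y, inb x -> inb y -> `|W y - W x| <= H * `|y - x|).
Context (W_slope : forall x, inb x -> slope W x (h x)).
Context (W_qs : W qs = 0) (W_gt0 : forall x, inb x -> x != qs -> 0 < W x).
Context (h_cont : {within `[0, b], continuous h}).
Context (h_sign : forall x, inb x -> x != qs -> 0 < h x * (x - qs)).

Definition energy (r q : R) : R := (r - e q) ^+ 2 / 2 + W q.

Lemma a_gt0 x : inb x -> 0 < a x.
Proof. by move=> /a_bound/andP[+ _]; exact: lt_le_trans. Qed.

Lemma W_ge0 x : inb x -> 0 <= W x.
Proof.
by move=> xb; have [->|xqs] := eqVneq x qs; [rewrite W_qs|rewrite ltW// W_gt0].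
Qed.

Lemma h_sign_ge0 x : inb x -> 0 <= h x * (x - qs).
Proof.
move=> xb; have [->|xqs] := eqVneq x qs; first by rewrite subrr mulr0.
by rewrite ltW// h_sign.
Qed.

Lemma W_continuous : {within `[0, b], continuous W}.
Proof.
apply: abs_continuous_within.
apply: (abs_continuous_lipschitz 0 b H id); first exact: abs_continuous_id.
by move=> x y x0 xy yb; apply: W_lip; lra.
Qed.

(** Sublevel sets of the energy shrink to the equilibrium: the kinetic part controls [r - e q], the
    potential controls [q - qs], and the Lipschitz bound on [e] links the two. *)
Lemma energy_lt_near (d : R) : 0 < d -> exists2 m : R, 0 < m &
  forall r q, inb q -> energy r q < m -> `|r - e qs| < d /\ `|q - qs| < d.
Proof.
move=> d0; have L1 : 0 < `|L| + 1 by rewrite ltr_wpDl.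
(* Within [d'] of [qs] the function [e] changes by less than [d / 2]; the value [d ^+ 2 / 8] used
   below forces [|r - e q| < d / 2]. *)
pose d' := Num.min d (d / (2 * (`|L| + 1))).
have d'0 : 0 < d' by rewrite lt_min d0 divr_gt0 ?mulr_gt0.
(* The penalty makes the minimum over the whole interval positive even at [qs], where [W] vanishes.
   It is zero at distance at least [d'] from [qs], so there the minimum bounds [W] itself from
   below. *)
have cN : {within `[0, b], continuous
    (fun x => W x + Num.max 0 (d' - `|x - qs|))}.
  move=> x; apply: cvgD; first exact: W_continuous.
  apply: cvg_max; first exact: cvg_cst.
  move: x; apply: continuous_subspaceT => y; apply: cvgB; first exact: cvg_cst.
  by apply: cvg_norm; apply: cvgB; [exact: cvg_id|exact: cvg_cst].
have b0 : 0 <= b by case/andP: qs_inb; exact: le_trans.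
have [c cb hc] := EVT_min b0 cN.
set m1 := W c + _ in hc.
have m10 : 0 < m1.
  move: cb; rewrite in_itv/= => cb; rewrite /m1.
  have [cqs|cqs] := eqVneq c qs.
    by rewrite cqs W_qs subrr normr0 subr0 add0r lt_max d'0 orbT.
  by rewrite ltr_pwDl ?W_gt0// le_max lexx.
exists (Num.min m1 (d ^+ 2 / 8)).
  by rewrite lt_min m10 divr_gt0 ?exprn_gt0.
move=> r q qb; rewrite lt_min /energy => /andP[E1 E2].
have Wq := W_ge0 _ qb.
have sq := sqr_ge0 (r - e q).
have qd : `|q - qs| < d'.
  rewrite ltNge; apply/negP => dq; have := hc q; rewrite in_itv/= => /(_ qb).
  have -> : Num.max 0 (d' - `|q - qs|) = 0 by apply/max_idPl; lra.
  lra.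
have vd : `|r - e q| < d / 2.
  rewrite -(ltr_pXn2r (ltn0Sn 1)) ?nnegrE//; last by lra.
  by rewrite real_normK ?num_real//; lra.
split; last by apply: lt_le_trans qd _; rewrite ge_min lexx.
have -> : r - e qs = (r - e q) + (e q - e qs) by ring.
apply: le_lt_trans (ler_normD _ _) _.
have := e_lip _ _ qs_inb qb.
have : L * `|q - qs| <= (`|L| + 1) * `|q - qs|.
  by apply: ler_wpM2r => //; have := ler_norm L; lra.
have : (`|L| + 1) * `|q - qs| < d / 2.
  rewrite mulrC -ltr_pdivlMr//; apply: lt_le_trans qd _.
  rewrite ge_min; apply/orP; right; rewrite invfM mulrA; exact: lexx.
lra.
Qed.

(** * Energy decay along one trajectory *)

Section trajectory.
Context (r q : R -> R).
Let v t := r t - e (q t).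
Context (q_inb : forall t, 0 <= t -> inb (q t)).
Context (r_ac : forall T, 0 <= T -> abs_continuous 0 T r).
Context (q_ac : forall T, 0 <= T -> abs_continuous 0 T q).

(* [w] is the velocity [v] cut off by the discontinuity: it vanishes while the
   trajectory slides along the switching line. *)
Definition oscillator_slope (t w : R) : Prop :=
  [/\ slope r t (- (a (q t) * h (q t)) - g (q t) * v t - a (q t) * w),
      slope q t (a (q t) * w) &
      w = v t \/ [/\ w = 0, 0 <= v t & eta <= h (q t)]].

Context (dynamics : {ae lebesgue_measure, forall t : R, 0 < t ->
  exists w, oscillator_slope t w}).

Lemma near_inb t : 0 < t -> \forall s \near t, inb (q s).
Proof.
move=> t0; exists t => // s /=; rewrite ltr_norml => /andP[_ st].
by apply: q_inb; lra.
Qed.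

(* A jump of the derivative of [e] is harmless because [e] is nondecreasing and
   [q] moves in the direction of [v]. *)
Lemma upper_slope_e t w : 0 < t -> oscillator_slope t w ->
  upper_slope (fun s => - v t * e (q s)) t 0.
Proof.
move=> t0 [_ sq wv]; have qt := q_inb _ (ltW t0).
have at0 := a_gt0 _ qt.
(* If [w = 0], then [q] has slope zero at [t], and so does [e (q s)] by the Lipschitz bound; this
   includes sliding. *)
have [w0|w0] := eqVneq w 0.
  move=> d d0.
  pose C := (`|L| + 1) * (`|v t| + 1).
  have C0 : 0 < C by rewrite mulr_gt0// ltr_wpDl.
  apply: filterS2 (near_inb _ t0) (sq _ (divr_gt0 d0 C0)) => s qsb.
  rewrite w0 mulr0 mul0r subr0 add0r => hs.
  apply: le_trans (ler_norm _) _.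
  rewrite -mulrBr !normrM normrN -(real_normK (num_real (s - t))) expr2 mulrA.
  apply: ler_wpM2r => //.
  apply: le_trans (_ : (`|v t| + 1) * ((`|L| + 1) * `|q s - q t|) <= _).
    apply: ler_pM => //; first by rewrite lerDl.
    apply: le_trans (e_lip _ _ qt qsb) _.
    by apply: ler_wpM2r => //; have := ler_norm L; lra.
  rewrite mulrA [X in X * _]mulrC -/C mulrC -ler_pdivlMr// mulrAC.
  exact: hs.
have [wE|[wE _ _]] := wv; last by rewrite wE eqxx in w0.
move=> d d0.
have v0 : 0 < `|v t| by rewrite normr_gt0 -wE.
(* This tolerance equals the size of the slope of [q], which is just enough for [q s - q t] to have
   the sign of [v t * (s - t)]. *)
have av0 : 0 < a (q t) * `|v t| by rewrite mulr_gt0.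
apply: filterS2 (near_inb _ t0) (sq _ av0) => s qsb hs.
apply: (@le_trans _ _ 0); last by rewrite mulr_ge0 ?sqr_ge0// add0r ltW.
rewrite -mulrBr mulNr mulNr oppr_le0 mulrAC.
have vDq : 0 <= v t * (s - t) * (q s - q t).
  move: hs; rewrite wE.
  set X := q s - q t => hs.
  have : `|v t * (s - t) * (X - a (q t) * v t * (s - t))| <=
     a (q t) * (v t * (s - t)) ^+ 2.
    rewrite normrM -(real_normK (num_real (v t * (s - t)))) normrM.
    have := ler_wpM2l (mulr_ge0 (normr_ge0 (v t)) (normr_ge0 (s - t))) hs.
    by congr (_ <= _); ring.
  rewrite ler_norml => /andP[+ _]; lra.
have [qst|qst|->] := ltgtP (q t) (q s); last by rewrite subrr mulr0.
- have D : 0 < q s - q t by rewrite subr_gt0.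
  rewrite pmulr_lge0// in vDq; rewrite mulr_ge0// subr_ge0.
  by apply: e_mono => //; exact: ltW.
- have D : q s - q t < 0 by rewrite subr_lt0.
  rewrite nmulr_lge0// in vDq; rewrite mulr_le0// subr_le0.
  by apply: e_mono => //; exact: ltW.
Qed.

(** The increment of [v ^+ 2 / 2] is exactly [v t] times the increment of [r], minus [v t] times the
    increment of [e (q s)], plus half the squared increment of [v]. The last has slope zero, and the
    middle one has upper slope zero by [upper_slope_e]. *)
Lemma energy_upper_slope t w : 0 < t -> oscillator_slope t w ->
  upper_slope (fun s => energy (r s) (q s)) t
    (- (a (q t) * h (q t) * (v t - w)) - g (q t) * v t ^+ 2
      - a (q t) * v t * w).
Proof.
move=> t0 os; have [sr sq _] := os; have qt := q_inb _ (ltW t0).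
have v_lip : exists2 K, 0 < K &
    \forall s \near t, `|v s - v t| <= K * `|s - t|.
  have rl := slope_lipschitz _ _ _ sr; have ql := slope_lipschitz _ _ _ sq.
  set K := `|_| + 1 in rl; set K' := `|_| + 1 in ql.
  have K0 : 0 < K by rewrite ltr_wpDl.
  have K'0 : 0 < K' by rewrite ltr_wpDl.
  exists (K + `|L| * K'); first by rewrite ltr_wpDr// mulr_ge0// ltW.
  apply: filterS3 (near_inb _ t0) rl ql => s qsb hr hq.
  have -> : v s - v t = (r s - r t) - (e (q s) - e (q t)) by rewrite /v; ring.
  apply: le_trans (ler_normB _ _) _; rewrite mulrDl lerD//.
  apply: le_trans (e_lip _ _ qt qsb) _.
  apply: le_trans (_ : `|L| * `|q s - q t| <= _).
    by rewrite ler_wpM2r// ler_norm.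
  by rewrite -mulrA ler_wpM2l.
have [K K0 vK] := v_lip.
have sv := slopeZ 2^-1 _ _ _ (slope_increments _ _ _ _ _ K0 K0 vK vK).
have sW := slope_comp _ _ _ _ _ sq (W_slope _ qt).
have := upper_slopeD _ _ _ _ _ (upper_slope_e _ _ t0 os)
  (slope_upper _ _ _ (slopeD _ _ _ _ _ (slopeZ (v t) _ _ _ sr)
    (slopeD _ _ _ _ _ sv sW))).
move=> /eq_upper_slope H0; apply: upper_slope_le (H0 _ _); first by lra.
by move=> s; rewrite /energy /v /=; field.
Qed.

Lemma energy_ac T : 0 <= T -> abs_continuous 0 T (fun s => energy (r s) (q s)).
Proof.
move=> T0.
have lip_q (F : R -> R) K :
    (forall x y, inb x -> inb y -> `|F y - F x| <= K * `|y - x|) ->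
    abs_continuous 0 T (fun s => F (q s)).
  move=> FK; apply: (abs_continuous_lipschitz 0 T K q); first exact: q_ac.
  by move=> x y x0 xy yT; apply: FK; apply: q_inb; lra.
have acv : abs_continuous 0 T (fun s => r s + -1 * e (q s)).
  apply: abs_continuousD; first exact: r_ac.
  by apply: abs_continuousZ; exact: (lip_q e L).
have := abs_continuousD _ _ _ _ (abs_continuousZ _ _ 2^-1 _
  (abs_continuousM _ _ _ _ T0 acv acv)) (lip_q _ _ W_lip).
by congr (abs_continuous 0 T _); apply/funext => s; rewrite /energy; field.
Qed.

Lemma energy_rate_le0 t w : 0 < t -> oscillator_slope t w ->
  - (a (q t) * h (q t) * (v t - w)) - g (q t) * v t ^+ 2
      - a (q t) * v t * w <= 0.
Proof.
move=> t0 [_ _ wv]; have qt := q_inb _ (ltW t0).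
have at0 := a_gt0 _ qt; have /andP[gt0 _] := g_bound _ qt.
have a_ge0 := ltW at0.
have := mulr_ge0 gt0 (sqr_ge0 (v t)).
case: wv => [->|[-> v0 hh]].
  have := mulr_ge0 a_ge0 (sqr_ge0 (v t)); lra.
have h0 := le_trans (ltW eta_gt0) hh.
have := mulr_ge0 (mulr_ge0 a_ge0 h0) v0; lra.
Qed.

Lemma energy_nonincreasing s t : 0 <= s -> s <= t ->
  energy (r t) (q t) <= energy (r s) (q s).
Proof.
move=> s0 st.
apply: (upper_slope_nonincreasing s t (fun s => energy (r s) (q s))) => //.
  apply: (abs_continuousS 0 t) => //.
  exact: energy_ac (le_trans s0 st).
apply: ae_lebesgueS dynamics => u hu su; have u0 : 0 < u by lra.
have [w os] := hu u0.
apply: upper_slope_le (energy_upper_slope _ _ u0 os).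
exact: energy_rate_le0.
Qed.

Lemma velocity_bounded : exists2 M, 0 < M &
  forall t, 0 <= t -> `|v t| <= M.
Proof.
(* With x the initial energy, v^2 <= 2 x <= (x + 1)^2, which avoids a square root. *)
pose M := energy (r 0) (q 0) + 1.
have W0 := W_ge0 _ (q_inb _ (lexx 0)).
have M0 : 0 < M.
  by rewrite /M /energy; have := sqr_ge0 (r 0 - e (q 0)); lra.
exists M => // t t0.
rewrite -(ler_pXn2r (ltn0Sn 1)) ?nnegrE//; last exact: ltW.
rewrite real_normK ?num_real//.
have := energy_nonincreasing _ _ (lexx 0) t0.
have := W_ge0 _ (q_inb _ t0).
have := sqr_ge0 (energy (r 0) (q 0)).
by rewrite /M [energy (r t) _]/energy -/(v t); lra.
Qed.

Lemma dissipation : exists2 c, 0 < c & forall t w, 0 < t ->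
  oscillator_slope t w ->
  upper_slope (fun s => energy (r s) (q s)) t (- c * v t ^+ 2).
Proof.
have [M M0 hM] := velocity_bounded.
(* Sliding dissipates at the rate [a0 * eta * v t], only linear in [v t]; since [v t <= M], this
   dominates a multiple of the square. *)
pose c := Num.min a0 (a0 * eta / M).
have c0 : 0 < c by rewrite lt_min a0_gt0 divr_gt0 ?mulr_gt0.
exists c => // t w t0 os.
apply: upper_slope_le (energy_upper_slope _ _ t0 os).
have [_ _ wv] := os; have qt := q_inb _ (ltW t0).
have /andP[gt0 _] := g_bound _ qt; have /andP[a0t _] := a_bound _ qt.
have gv0 := mulr_ge0 gt0 (sqr_ge0 (v t)).
case: wv => [->|[-> v0 hh]].
  have ca : c <= a (q t) by apply: le_trans a0t; rewrite ge_min lexx.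
  have := ler_wpM2r (sqr_ge0 (v t)) ca; lra.
have vM : v t <= M by apply: le_trans (ler_norm _) (hM _ (ltW t0)).
have cM : c * M <= a0 * eta.
  by rewrite -ler_pdivlMr// ge_min lexx orbT.
have ah : a0 * eta <= a (q t) * h (q t) by apply: ler_pM => //; exact: ltW.
have := ler_wpM2r v0 (le_trans cM ah).
have := ler_wpM2l (mulr_ge0 (ltW c0) v0) vM.
lra.
Qed.

(** Same penalty device as in [energy_lt_near]: the added term is positive at [qs] and vanishes
    where [d <= W x]. *)
Lemma displacement_coercive d : 0 < d -> exists2 k, 0 < k &
  forall x, inb x -> d <= W x -> k <= h x * (x - qs).
Proof.
move=> d0.
have cN : {within `[0, b], continuous
    (fun x => h x * (x - qs) + Num.max 0 (d - W x))}.
  move=> x; apply: cvgD.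
    apply: cvgM; first exact: h_cont.
    apply: (@continuous_subspaceT _ _ _ (fun y => y - qs)) => y.
    by apply: cvgB; [exact: cvg_id|exact: cvg_cst].
  apply: cvg_max; first exact: cvg_cst.
  by apply: cvgB; [exact: cvg_cst|exact: W_continuous].
have b0 : 0 <= b by case/andP: qs_inb; exact: le_trans.
have [c cb hc] := EVT_min b0 cN.
set m := h c * _ + _ in hc; exists m.
  move: cb; rewrite in_itv/= => cb; rewrite /m.
  have [cqs|cqs] := eqVneq c qs.
    by rewrite cqs W_qs subrr mulr0 subr0 add0r lt_max d0 orbT.
  by rewrite ltr_pwDl ?h_sign// le_max lexx.
move=> x xb dW; have := hc x; rewrite in_itv/= => /(_ xb).
have -> : Num.max 0 (d - W x) = 0 by apply/max_idPl; lra.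
by rewrite addr0.
Qed.

(** By contradiction. If the energy stays above [d], then at each time either [W >= d / 2], and the
    restoring term in the derivative of [(q - qs) * r] is bounded away from zero, or [v ^+ 2 >= d],
    and the dissipation is. Either way a bounded-below quantity falls at rate at least [k']
    forever. *)
Lemma energy_to0 d : 0 < d ->
  exists2 t, 0 <= t & energy (r t) (q t) < d.
Proof.
move=> d0; apply: contrapT => noT.
have Ed t : 0 <= t -> d <= energy (r t) (q t).
  by move=> t0; rewrite leNgt; apply/negP => Et; apply: noT; exists t.
have [M M0 hM] := velocity_bounded.
have [c c0 hE] := dissipation.
have [k k0 hk] := displacement_coercive _ (divr_gt0 d0 (ltr0n _ 2)).
pose Mr := M + `|e qs| + `|L| * b.
have b0 : 0 <= b by case/andP: qs_inb; exact: le_trans.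
have qsb0 t : 0 <= t -> `|q t - qs| <= b.
  move=> /q_inb; move: qs_inb => /andP[? ?] /andP[? ?].
  by rewrite ler_norml; lra.
have Mr0 : 0 <= Mr by rewrite !addr_ge0 ?mulr_ge0// ltW.
have rM t : 0 <= t -> `|r t| <= Mr.
  move=> t0; have -> : r t = v t + e qs + (e (q t) - e qs) by rewrite /v; ring.
  apply: le_trans (ler_normD _ _) _; apply: lerD.
    by apply: le_trans (ler_normD _ _) _; rewrite lerD2r hM.
  apply: le_trans (e_lip _ _ qs_inb (q_inb _ t0)) _.
  apply: le_trans (_ : `|L| * `|q t - qs| <= _).
    by rewrite ler_wpM2r// ler_norm.
  by rewrite ler_wpM2l// qsb0.
(* [C] collects the coefficients of [|v|] in the derivative of [(q - qs) * r]: [A * Mr] from the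
   motion of [q], [b * G] and [b * A] from the terms of the [r] equation in [v] and [w]. *)
pose C := A * Mr + b * (G + A).
have [k' k'0 k'E] : exists2 k', 0 < k' & a0 * k = 2 * k'.
  exists (a0 * k / 2); first by rewrite divr_gt0// mulr_gt0.
  by field.
have k'_ge0 := ltW k'0.
(* The first condition keeps [C * x - D * x ^+ 2] at most [k'] for all [x], half of what the
   restoring term [a0 * k] recovers; the second pushes it below [- k'] once [x ^+ 2 >= d]. *)
have [D D0 [D1 D2]] : exists2 D, 0 < D &
    C ^+ 2 <= 2 * k' * D /\ 4 * k' <= D * d.
  have p1 : 0 <= C ^+ 2 / (2 * k') by rewrite divr_ge0 ?sqr_ge0// mulr_ge0.
  have p2 : 0 < 4 * k' / d by rewrite divr_gt0// mulr_gt0.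
  exists (C ^+ 2 / (2 * k') + 4 * k' / d); first by rewrite ltr_wpDl.
  split.
    have -> : 2 * k' * (C ^+ 2 / (2 * k') + 4 * k' / d) =
        C ^+ 2 + 2 * k' * (4 * k' / d) by field; rewrite !gt_eqF.
    by rewrite lerDl (mulr_ge0 (mulr_ge0 (ler0n _ 2) k'_ge0) (ltW p2)).
  have -> : (C ^+ 2 / (2 * k') + 4 * k' / d) * d =
      C ^+ 2 / (2 * k') * d + 4 * k' by field; rewrite !gt_eqF.
  by rewrite lerDr (mulr_ge0 p1 (ltW d0)).
have quad (x : R) : C * x - D * x ^+ 2 <= k' /\
    (d <= x ^+ 2 -> C * x - D * x ^+ 2 <= - k').
  have Dk := mulr_gt0 D0 k'0.
  split.
    rewrite -(ler_pM2l D0).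
    by have := sqr_ge0 (D * x - C / 2); have := sqr_ge0 C; lra.
  move=> dx; rewrite -(ler_pM2l D0).
  have := ler_wpM2l (mulr_ge0 (ltW D0) (ltW D0)) dx.
  have := ler_wpM2l (ltW D0) D2.
  have := sqr_ge0 (D * x - C); lra.
(* The factor [D / c] turns the dissipation into [- D * v t ^+ 2]. The summand [k' * t] encodes
   decrease at rate [k'] as mere monotonicity of [V]. *)
pose V t := (q t + - qs) * r t + D / c * energy (r t) (q t) + k' * t.
have c1 : D / c * c = D by rewrite divfK ?gt_eqF.
have Vslope t w : 0 < t -> oscillator_slope t w -> upper_slope V t 0.
  move=> t0 os; have [sr sq wv] := os.
  have qt := q_inb _ (ltW t0).
  have s_qs : slope (fun s => q s + - qs) t (a (q t) * w).
    by move=> x x0; have := sq x x0; apply: filterS => s;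
      congr (`|_| <= _); ring.
  have s_t : slope (fun s => k' * s) t k'.
    move=> x x0; apply: filterE => s.
    by rewrite -mulrBr subrr normr0 mulr_ge0// ltW.
  have Dc0 : 0 <= D / c by rewrite divr_ge0// ltW.
  have := upper_slopeD _ _ _ _ _
    (upper_slopeD _ _ _ _ _ (slope_upper _ _ _ (slopeM _ _ _ _ _ s_qs sr))
      (upper_slopeZ _ _ _ _ Dc0 (hE _ _ t0 os)))
    (slope_upper _ _ _ s_t).
  apply: upper_slope_le.
  rewrite mulrA mulrN c1.
  have wle : `|w| <= `|v t| by case: wv => [->//|[-> _ _]]; rewrite normr0.
  have /andP[a0t aA] := a_bound _ qt; have /andP[g0 gG] := g_bound _ qt.
  have at0 := ltW (a_gt0 _ qt); have A0 := le_trans at0 aA.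
  have G0 := le_trans g0 gG.
  have t1 : a (q t) * w * r t <= A * Mr * `|v t|.
    apply: le_trans (ler_norm _) _; rewrite !normrM (ger0_norm at0).
    rewrite mulrAC; apply: ler_pM => //; first by rewrite mulr_ge0.
    by apply: ler_pM => //; exact: rM (ltW t0).
  have t2 : - ((q t - qs) * (g (q t) * v t)) <= b * G * `|v t|.
    apply: le_trans (ler_norm _) _; rewrite normrN !normrM (ger0_norm g0) mulrA.
    apply: ler_pM => //; first by rewrite mulr_ge0.
    by apply: ler_pM => //; exact: qsb0 (ltW t0).
  have t3 : - ((q t - qs) * (a (q t) * w)) <= b * A * `|v t|.
    apply: le_trans (ler_norm _) _.
    rewrite normrN !normrM (ger0_norm at0) mulrA.
    apply: ler_pM => //; first by rewrite mulr_ge0.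
    by apply: ler_pM => //; exact: qsb0 (ltW t0).
  have t4 : a0 * (h (q t) * (q t - qs)) <= a (q t) * (h (q t) * (q t - qs)).
    by rewrite ler_wpM2r// h_sign_ge0.
  have h0 := mulr_ge0 (ltW a0_gt0) (h_sign_ge0 _ qt).
  have [Q1 Q2] := quad `|v t|.
  rewrite real_normK ?num_real// in Q1 Q2.
  have main : C * `|v t| - D * v t ^+ 2 - a0 * (h (q t) * (q t - qs)) <= - k'.
    have [W1|W1] := leP (d / 2) (W (q t)).
      have := ler_wpM2l (ltW a0_gt0) (hk _ qt W1).
      by rewrite k'E; lra.
    have := Ed _ (ltW t0); rewrite /energy -/(v t) => Edt.
    have /Q2 : d <= v t ^+ 2 by lra.
    lra.
  move: main; rewrite /C; lra.
have Vac T : 0 <= T -> abs_continuous 0 T V.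
  move=> T0; apply: abs_continuousD; last first.
    by apply: abs_continuousZ; exact: abs_continuous_id.
  apply: abs_continuousD; last exact: abs_continuousZ (energy_ac _ T0).
  apply: abs_continuousM => //; last exact: r_ac.
  apply: (abs_continuous_lipschitz 0 T 1 q); first exact: q_ac.
  by move=> x y _ _ _; rewrite mul1r opprD addrACA subrr addr0.
pose B := V 0 + b * Mr.
have VT T : 0 <= T -> k' * T <= B.
  move=> T0.
  have : V T <= V 0.
    apply: (upper_slope_nonincreasing 0 T V T0 (Vac _ T0)).
    apply: ae_lebesgueS dynamics => t ht t0.
    by have [w os] := ht t0; exact: Vslope os.
  have : - (b * Mr) <= (q T - qs) * r T.
    rewrite lerNl; apply: le_trans (ler_norm _) _; rewrite normrN normrM.
    by apply: ler_pM => //; [exact: qsb0|exact: rM].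
  have : 0 <= D / c * energy (r T) (q T).
    rewrite mulr_ge0 ?divr_ge0 ?(ltW D0) ?(ltW c0)//.
    by rewrite (le_trans (ltW d0))// Ed.
  rewrite /B {1}/V; lra.
(* At this time [k' * T] equals [|B| + k'], which exceeds [B]. *)
have T0 : 0 <= `|B| / k' + 1 by rewrite addr_ge0// divr_ge0.
have := VT _ T0; rewrite mulrDr mulr1 mulrCA divff ?gt_eqF// mulr1.
by have := ler_norm B; lra.
Qed.

Lemma trajectory_cvg d : 0 < d -> exists2 T, 0 <= T &
  forall t, T <= t -> `|r t - e qs| < d /\ `|q t - qs| < d.
Proof.
move=> d0; have [m m0 hm] := energy_lt_near _ d0.
have [T T0 ET] := energy_to0 _ m0.
exists T => // t Tt; apply: hm; first exact: q_inb _ (le_trans T0 Tt).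
exact: le_lt_trans (energy_nonincreasing _ _ T0 Tt) ET.
Qed.

End trajectory.

(** Converse of [energy_lt_near], needed for stability. For [d <= 1] the kinetic part, quadratic in
    [d], is also linearly bounded, so the energy is below [K * d]. *)
Lemma energy_small m : 0 < m -> exists2 d, 0 < d & forall r q : R, inb q ->
  `|r - e qs| < d -> `|q - qs| < d -> energy r q < m.
Proof.
move=> m0; pose K := (1 + `|L|) ^+ 2 / 2 + `|H|.
have L1 : 0 < 1 + `|L| by rewrite ltr_pwDl.
have K0 : 0 < K by rewrite ltr_pwDl// divr_gt0// exprn_gt0.
exists (Num.min 1 (m / K)); first by rewrite lt_min ltr01 divr_gt0.
move=> r q qb; set d := Num.min _ _ => rd qd.
have d0 : 0 <= d := le_trans (normr_ge0 _) (ltW rd).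
have d1 : d <= 1 by rewrite ge_min lexx.
have dK : d * K <= m by rewrite -ler_pdivlMr// ge_min lexx orbT.
have lip (C : R) : C * `|q - qs| <= `|C| * `|q - qs|.
  by rewrite ler_wpM2r// ler_norm.
have We : W q <= `|H| * `|q - qs|.
  have := le_trans (W_lip _ _ qs_inb qb) (lip H).
  by rewrite W_qs subr0; apply: le_trans; exact: ler_norm.
have ve : `|r - e q| < (1 + `|L|) * d.
  have -> : r - e q = (r - e qs) - (e q - e qs) by ring.
  apply: le_lt_trans (ler_normB _ _) _; rewrite mulrDl mul1r ltr_leD//.
  apply: le_trans (e_lip _ _ qs_inb qb) _; apply: le_trans (lip L) _.
  by rewrite ler_wpM2l// ltW.
have v2 : (r - e q) ^+ 2 < (1 + `|L|) ^+ 2 * d.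
  rewrite -(real_normK (num_real _)).
  apply: lt_le_trans (_ : _ < ((1 + `|L|) * d) ^+ 2) _.
    by rewrite ltr_pXn2r// nnegrE// mulr_ge0// ltW.
  rewrite exprMn ler_wpM2l ?sqr_ge0// expr2.
  by rewrite ler_piMl.
have Wd : `|H| * `|q - qs| <= `|H| * d by rewrite ler_wpM2l// ltW.
rewrite /energy; move: dK; rewrite /K; lra.
Qed.

End damped_oscillator.
(** * Calculus on the half-line *)

Section calculus.
Context {R : realType}.
Implicit Types (u du h : R -> R).

Lemma slope_is_derive u (t k : R) : slope u t k -> is_derive t 1 u k.
Proof.
move=> su.
have c : (fun s => s^-1 *: (u (s *: 1 + t) - u t)) @ 0^' --> k.
  apply/cvgrPdist_le => e e0; have [r /= r0 hr] := su e e0.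
  exists r => // s /=; rewrite sub0r normrN => sr s0.
  have := hr (s + t); rewrite /= opprD addrCA subrr addr0 normrN => /(_ sr).
  rewrite addrK -[s *: 1]/(s * 1) mulr1 -[_ *: _]/(_ * _).
  have -> : k - s^-1 * (u (s + t) - u t) =
      - (s^-1 * (u (s + t) - u t - k * s)) by field.
  rewrite normrN normrM normfV => h.
  by rewrite mulrC ler_pdivrMr// normr_gt0.
by split; [apply/cvg_ex; exists k|exact: cvg_lim c].
Qed.

Lemma derivative_Rplus_near u du (x e : R) :
  derivative_Rplus u du -> 0 <= x -> 0 < e ->
  \forall y \near x, 0 <= y ->
    `|u y - u x - du x * (y - x)| <= e * `|y - x|.
Proof.
move=> hu x0 e0; have /cvgrPdist_le /(_ _ e0)[r /= r0 hr] := hu x x0.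
exists r => // y /= xyr y0; have [->|yx] := eqVneq y x.
  by rewrite !subrr mulr0 subr0 normr0 mulr0.
have yx0 : y - x != 0 by rewrite subr_eq0.
have := hr y xyr yx; rewrite /= in_itv/= y0 => /(_ isT) h.
have -> : u y - u x - du x * (y - x) =
  - (du x - (u y - u x) / (y - x)) * (y - x) by field.
by rewrite normrM normrN ler_wpM2r.
Qed.

Lemma derivative_Rplus_is_derive u du (x : R) :
  derivative_Rplus u du -> 0 < x -> is_derive x 1 u (du x).
Proof.
move=> hu x0; apply: slope_is_derive => e e0.
have xp : \forall y \near x, 0 <= y.
  by exists x => // y /=; rewrite ltr_norml => /andP[_ h]; lra.
have := derivative_Rplus_near _ _ _ _ hu (ltW x0) e0.
by apply: filterS2 xp => y y0; exact.
Qed.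

Lemma derivative_Rplus_continuous u du :
  derivative_Rplus u du -> {within `[0, +oo[, continuous u}.
Proof.
move=> hu; apply/subspace_continuousP => x /=; rewrite in_itv/= andbT => x0.
apply/cvgrPdist_le => e e0; rewrite near_withinE.
have K0 : 0 < `|du x| + 1 by rewrite ltr_wpDl.
have xr : \forall y \near x, `|y - x| <= e / (`|du x| + 1).
  by exists (e / (`|du x| + 1)) => /= [|y /ltW];
    [rewrite divr_gt0|rewrite distrC].
apply: filterS2 xr (derivative_Rplus_near _ _ _ _ hu x0 ltr01) => y hy hd.
rewrite /= in_itv/= andbT => /hd; rewrite mul1r => {}hd.
have -> : u x - u y = - ((u y - u x - du x * (y - x)) + du x * (y - x)) by ring.
rewrite normrN; apply: le_trans (ler_normD _ _) _; rewrite normrM.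
have := ler_wpM2l (ltW K0) hy; rewrite [_ * (e / _)]mulrC divfK ?gt_eqF//.
lra.
Qed.

Lemma continuous_derivative_lipschitz u du (a b : R) :
  (forall x, x \in `]a, b[ -> is_derive x 1 u (du x)) ->
  {within `[a, b], continuous u} -> {within `[a, b], continuous du} ->
  exists L : R, forall x y, a <= x <= b -> a <= y <= b ->
    `|u y - u x| <= L * `|y - x|.
Proof.
move=> hu cu cdu.
have [ab|ba] := leP a b; last first.
  by exists 0 => x y /andP[ax xb]; have := le_trans ax xb; lra.
have cn : {within `[a, b], continuous (fun x => `|du x|)}.
  by move=> x; apply: cvg_norm; exact: cdu.
have [c _ hc] := EVT_max ab cn.
exists `|du c|.
have main x y : a <= x -> x < y -> y <= b -> `|u y - u x| <= `|du c| * `|y - x|.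
  move=> ax xy yb.
  have d z : z \in `]x, y[ -> is_derive z 1 u (du z).
    by rewrite in_itv/= => /andP[xz zy]; apply: hu; rewrite in_itv/=; lra.
  have c' : {within `[x, y], continuous u}.
    apply: continuous_subspaceW cu => w /=; rewrite !in_itv/= => /andP[xw wy].
    lra.
  have [z] := MVT xy d c'.
  rewrite in_itv/= => /andP[xz zy] ->; rewrite normrM ler_wpM2r//.
  by apply: hc; rewrite in_itv/=; lra.
move=> x y /andP[ax xb] /andP[ay yb].
have [xy|yx|->] := ltgtP x y; [exact: main| |].
  by rewrite distrC (distrC y); exact: main.
by rewrite !subrr normr0 mulr0.
Qed.

Lemma within_comp_continuous (A : set R) h u : {within A, continuous h} ->
  continuous u -> (forall x, A (u x)) -> continuous (h \o u).
Proof.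
move=> /subspace_continuousP ch cu Au x; apply/cvgrPdist_lt => e e0.
have /cvgrPdist_lt /(_ _ e0) := ch _ (Au x).
rewrite near_withinE => -[r /= r0 hr].
move/cvgrPdist_lt : (cu x) => /(_ _ r0); apply: filterS => y xyr.
exact: hr.
Qed.

(** Extending [h] by its end values and integrating from [a - 1] makes the derivative two-sided at
    [a] and [b] as well. The chain rule along a trajectory needs this at times when [q] sits on the
    boundary, in particular while sliding. *)
Lemma antiderivative_itv h (a b : R) : a <= b ->
  {within `[a, b], continuous h} ->
  exists W : R -> R, forall x, a <= x <= b -> is_derive x 1 W (h x).
Proof.
move=> ab ch; pose k x := h (Num.max a (Num.min x b)).
have ck : continuous k.
  apply: (within_comp_continuous _ _ _ ch) => [y|y]; last first.
    by rewrite /= in_itv/= le_max lexx ge_max ab ge_min lexx orbT.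
  apply: cvg_max; first exact: cvg_cst.
  by apply: (@continuous_min R R id (fun=> b)); [exact: cvg_id|exact: cvg_cst].
exists (fun x => \int[lebesgue_measure]_(t in `[a - 1, x]) k t)%R.
move=> x /andP[ax xb].
have kx : k x = h x by rewrite /k min_l// max_r.
have xb1 : x < b + 1 by lra.
have ax1 : a - 1 < x by lra.
have ik : lebesgue_measure.-integrable `[a - 1, b + 1] (EFin \o k).
  apply: continuous_compact_integrable; first exact: segment_compact.
  exact: continuous_subspaceT.
have [dk k'] := continuous_FTC1_closed xb1 ik ax1 (ck x).
by split => //; rewrite -kx -k' derive1E.
Qed.

End calculus.

(** * Barriers and sign changes of scalar functions *)

Lemma upper_barrier {R : realType} (b : R) (q : R -> R) :
  (forall T, 0 <= T -> abs_continuous 0 T q) ->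
  {ae lebesgue_measure, forall t : R, 0 < t ->
    exists2 k, slope q t k & b <= q t -> k <= 0} ->
  q 0 <= b -> forall t, 0 <= t -> q t <= b.
Proof.
move=> qac dyn q0 t t0; pose g s := Num.max 0 (q s - b).
suff : g t <= g 0.
  rewrite /g [X in _ <= X]max_l; last by rewrite subr_le0.
  by rewrite ge_max lexx subr_le0.
apply: (upper_slope_nonincreasing 0 t g t0).
  apply: (abs_continuous_lipschitz 0 t 1 q); first exact: qac.
  move=> x y _ _ _; rewrite mul1r /g.
  have := ler_norm (q y - q x); have := ler_norm (q x - q y).
  rewrite (distrC (q x)) ler_norml => h1 h2.
  by apply/andP; split; case: (leP 0 (q y - b)); case: (leP 0 (q x - b)); lra.
apply: ae_lebesgueS dyn => s hs s0; have [k sk kb] := hs s0.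
have [bq|qb] := leP b (q s); last first.
  move=> e e0; have := slope_lipschitz _ _ _ sk.
  set K := `|k| + 1; have K0 : 0 < K by rewrite ltr_wpDl.
  have r0 : 0 < (b - q s) / K by rewrite divr_gt0// subr_gt0.
  have ys : \forall y \near s, `|y - s| < (b - q s) / K.
    by exists ((b - q s) / K) => //= y; rewrite distrC.
  apply: filterS2 ys => y; rewrite ltr_pdivlMr// mulrC => yr hy.
  have := le_lt_trans (le_trans (ler_norm _) hy) yr => qy.
  rewrite /g max_l; last by lra.
  rewrite max_l; last by lra.
  by rewrite subrr mul0r add0r mulr_ge0 ?sqr_ge0// ltW.
have := slope_upper _ _ _ sk => us e e0; have := us e e0.
apply: filterS => y h.
have h' : (q y - q s) * (y - s) <= (0 + e) * (y - s) ^+ 2.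
  by apply: le_trans h _; rewrite ler_wpM2r ?sqr_ge0// lerD2r kb.
have e2 : 0 <= (0 + e) * (y - s) ^+ 2.
  by rewrite add0r mulr_ge0 ?sqr_ge0// ltW.
have -> : g s = q s - b by rewrite /g max_r// subr_ge0.
(* If [q] has dropped below [b] at [y], truncation matters: for [y >= s] the product is nonpositive
   outright, and for [y < s] truncation only lowers it. *)
rewrite /g; have [yb|by_] := leP 0 (q y - b).
  by apply: le_trans h'; rewrite opprB addrA subrK.
have [ys|sy] := leP 0 (y - s).
  apply: le_trans e2; apply: mulr_le0_ge0 => //; lra.
apply: le_trans h'; rewrite -subr_ge0 -mulrBl.
apply: mulr_le0 => //; last exact: ltW.
lra.
Qed.

(** A wrong sign would, by the intermediate value theorem, produce a zero other than [qs]: between 0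
    and [x] on the left of [qs], and on the right between [x] and a point near [qu] where [k] is
    positive. *)
Lemma crossing_sign {R : realType} (k : R -> R) (qs qu : R) :
  0 < qs -> {within `[0, qu], continuous k} -> k 0 < 0 ->
  (forall x, 0 < x < qu -> k x = 0 -> x = qs) ->
  (forall x, x < qu -> exists2 z, x < z < qu & 0 < k z) ->
  forall x, 0 <= x < qu -> x != qs -> 0 < k x * (x - qs).
Proof.
move=> qs0 ck k0 zero left_qu x /andP[x0 xqu] xqs.
have ivt y z : 0 <= y -> y <= z -> z < qu -> k y < 0 -> 0 <= k z ->
    exists2 c, y < c <= z & k c = 0.
  move=> y0 yz zqu ky kz.
  have cyz : {within `[y, z], continuous k}.
    apply: continuous_subspaceW ck => w /=; rewrite !in_itv/= => /andP[? ?].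
    by apply/andP; split; lra.
  have [|c] := @IVT _ k y z 0 yz cyz.
    by rewrite ge_min le_max (ltW ky) kz orbT.
  rewrite in_itv/= => /andP[yc cz] kc; exists c => //; rewrite cz andbT.
  rewrite lt_neqAle yc andbT; apply/eqP => ycE.
  by move: ky; rewrite ycE kc ltxx.
have [xlt|xgt|xE] := ltgtP x qs; last by rewrite xE eqxx in xqs.
- rewrite nmulr_lgt0 ?subr_lt0// ltNge; apply/negP => kx.
  have [c /andP[c0 cx] kc] := ivt 0 x (lexx 0) x0 xqu k0 kx.
  have : c = qs by apply: zero => //; rewrite c0 (le_lt_trans cx).
  by move=> cqs; move: cx; rewrite cqs leNgt xlt.
- rewrite pmulr_lgt0 ?subr_gt0// ltNge; apply/negP => kx.
  have kx0 : k x < 0.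
    rewrite lt_neqAle kx andbT; apply/eqP => kx0.
    by move/eqP : xqs; apply; apply: zero kx0; rewrite xqu (lt_trans qs0).
  have [z /andP[xz zqu] kz] := left_qu x xqu.
  have [c /andP[xc cz] kc] := ivt x z x0 (ltW xz) zqu kx0 (ltW kz).
  have : c = qs.
    by apply: zero kc; rewrite (le_lt_trans x0 xc) (le_lt_trans cz).
  by move=> cqs; move: xc; rewrite cqs ltNge (ltW xgt).
Qed.

Lemma gt0_left_of_zero {R : realType} (u : R -> R) (x k : R) :
  slope u x k -> u x = 0 -> k < 0 ->
  forall y, y < x -> exists2 z, y < z < x & 0 < u z.
Proof.
move=> su ux k0 y yx.
have k2 : 0 < - k / 2 by lra.
have [r /= r0 hr] := su _ k2.
pose z := x - Num.min (x - y) r / 2.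
have m0 : 0 < Num.min (x - y) r by rewrite lt_min r0 subr_gt0 yx.
have m1 : Num.min (x - y) r <= x - y by rewrite ge_min lexx.
have m2 : Num.min (x - y) r <= r by rewrite ge_min lexx orbT.
have xz : 0 < x - z by rewrite /z; lra.
exists z; first by apply/andP; split; rewrite /z; lra.
have zr : `|x - z| < r by rewrite ger0_norm ?(ltW xz)// /z; lra.
have := hr z zr.
rewrite ux [X in _ <= _ * X]distrC (ger0_norm (ltW xz)) ler_norml => /andP[h _].
have := mulr_gt0 k2 xz; lra.
Qed.

(** * The modified system *)

Section model_coefficients.
Context {R : realType}.
Implicit Types (q : R).

Lemma priceE (beta qm q : R) : 0 < beta -> 0 < qm -> 0 <= q ->
  price beta qm q = beta * Num.max 0 (Num.min q (2 * qm - q)).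
Proof.
move=> b0 qm0 q0; rewrite /price; case: ifPn => [qqm|].
  by rewrite min_l ?max_r//; lra.
rewrite -ltNge => qmq; rewrite min_r; last by lra.
case: ifPn => [q2|]; first by rewrite max_r//; lra.
by rewrite -ltNge => q2; rewrite max_l ?mulr0//; lra.
Qed.

Lemma price_ge0 (beta qm q : R) : 0 < beta -> 0 < qm -> 0 <= q ->
  0 <= price beta qm q.
Proof.
by move=> b0 qm0 q0; rewrite priceE// mulr_ge0 ?(ltW b0)// le_max lexx.
Qed.

(** [price] is negative left of 0, where [f] carries no information. The clamped formula [P] is
    nonnegative everywhere and agrees with [price] on the half-line. *)
Lemma comp_price_continuous (beta qm : R) (f df : R -> R) :
  0 < beta -> 0 < qm -> C1_Rplus f df ->
  {within `[0, +oo[, continuous (f \o price beta qm)}.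
Proof.
move=> b0 qm0 [f' _].
pose P q := beta * Num.max 0 (Num.min q (2 * qm - q)).
have cP : continuous (f \o P).
  apply: within_comp_continuous (derivative_Rplus_continuous _ _ f') _ _.
    move=> x; apply: cvgM; first exact: cvg_cst.
    apply: cvg_max; first exact: cvg_cst.
    apply: (@continuous_min R R id (fun q => 2 * qm - q)); first exact: cvg_id.
    by apply: cvgB; [exact: cvg_cst|exact: cvg_id].
  by move=> x; rewrite /= in_itv/= andbT mulr_ge0 ?(ltW b0)// le_max lexx.
apply: (@subspace_eq_continuous _ _ _ (f \o P));
  last exact: continuous_subspaceT.
move=> x; rewrite inE/= in_itv/= andbT => x0.
by rewrite [RHS]/= /from_subspace /= priceE.
Qed.

Lemma serviceE (mus qc q : R) : 0 < qc ->
  service mus qc q = mus / qc * Num.min q qc.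
Proof.
move=> qc0; rewrite /service; case: ifPn => [?|]; first by rewrite min_l.
by rewrite -ltNge => /ltW h; rewrite min_r// divfK ?gt_eqF.
Qed.

Lemma service_mono (mus qc x y : R) : 0 < mus -> 0 < qc -> x <= y ->
  service mus qc x <= service mus qc y.
Proof.
move=> m0 qc0 xy; rewrite !serviceE// ler_wpM2l ?(ltW (divr_gt0 m0 qc0))//.
by rewrite le_min !ge_min xy lexx orbT.
Qed.

Lemma service_lipschitz (mus qc x y : R) : 0 < mus -> 0 < qc ->
  `|service mus qc y - service mus qc x| <= mus / qc * `|y - x|.
Proof.
move=> m0 qc0; rewrite !serviceE// -mulrBr normrM.
have mq := divr_gt0 m0 qc0.
rewrite (gtr0_norm mq) ler_wpM2l ?(ltW mq)//.
have := ler_norm (y - x); have := ler_norm (x - y).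
rewrite (distrC x) ler_norml => h1 h2.
by apply/andP; split; case: (leP y qc); case: (leP x qc); lra.
Qed.

Lemma service_le (mus qc x : R) : 0 < mus -> 0 < qc -> service mus qc x <= mus.
Proof.
move=> m0 qc0; rewrite serviceE// -[leRHS](divfK (lt0r_neq0 qc0)).
by rewrite ler_wpM2l ?(ltW (divr_gt0 m0 qc0))// ge_min lexx orbT.
Qed.

Lemma service_sat (mus qc x y : R) : 0 < mus -> 0 < qc ->
  service mus qc x = mus -> x <= y -> service mus qc y = mus.
Proof.
move=> m0 qc0 xm xy; apply/le_anti; rewrite service_le//=.
by rewrite -{1}xm service_mono.
Qed.

Lemma service_ge0 (mus qc x : R) : 0 < mus -> 0 < qc -> 0 <= x ->
  0 <= service mus qc x.
Proof.
move=> m0 qc0 x0; rewrite serviceE// mulr_ge0 ?(ltW (divr_gt0 m0 qc0))//.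
by rewrite le_min x0 ltW.
Qed.

End model_coefficients.

(** * Potentials and stability of the abstract oscillator *)

Lemma ratio_lipschitz {R : realType} (u v : R -> R) (a b M c Lu Lv : R) :
  0 < c -> (forall x, a <= x <= b -> c <= v x) ->
  (forall x, a <= x <= b -> `|u x| <= M) ->
  (forall x y, a <= x <= b -> a <= y <= b -> `|u y - u x| <= Lu * `|y - x|) ->
  (forall x y, a <= x <= b -> a <= y <= b -> `|v y - v x| <= Lv * `|y - x|) ->
  forall x y, a <= x <= b -> a <= y <= b ->
    `|u y / v y - u x / v x| <= (Lu / c + M * Lv / c ^+ 2) * `|y - x|.
Proof.
move=> c0 cv uM uL vL x y xab yab.
have vx := lt_le_trans c0 (cv _ xab); have vy := lt_le_trans c0 (cv _ yab).
have ix : (v x)^-1 <= c^-1 by rewrite lef_pV2 ?posrE// cv.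
have iy : (v y)^-1 <= c^-1 by rewrite lef_pV2 ?posrE// cv.
have -> : u y / v y - u x / v x =
    (u y - u x) / v y - u x * (v y - v x) * ((v x)^-1 * (v y)^-1).
  by field; rewrite !gt_eqF.
apply: le_trans (ler_normB _ _) _; rewrite [leRHS]mulrDl; apply: lerD.
  rewrite normrM (@gtr0_norm _ (v y)^-1) ?invr_gt0// mulrAC.
  by apply: ler_pM => //; [rewrite invr_ge0 ltW|exact: uL].
rewrite normrM (@gtr0_norm _ ((v x)^-1 * _)) ?mulr_gt0 ?invr_gt0//.
rewrite [leRHS]mulrAC expr2 invfM; apply: ler_pM => //.
- by rewrite mulr_ge0 ?invr_ge0 ?(ltW vx) ?(ltW vy).
- rewrite normrM -mulrA; apply: ler_pM => //; [exact: uM|exact: vL].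
- by apply: ler_pM => //; rewrite invr_ge0 ?(ltW vx) ?(ltW vy).
Qed.

(** Positivity comes from the mean value theorem between [c] and [x]: the intermediate point lies on
    the same side of [c] as [x], so [h] there has the sign of [x - c]. *)
Lemma potential {R : realType} (h : R -> R) (a b c : R) :
  a <= c <= b -> {within `[a, b], continuous h} ->
  (forall x, a <= x <= b -> x != c -> 0 < h x * (x - c)) ->
  exists W : R -> R, exists H : R,
    [/\ forall x, a <= x <= b -> slope W x (h x),
        forall x y, a <= x <= b -> a <= y <= b -> `|W y - W x| <= H * `|y - x|,
        W c = 0 &
        forall x, a <= x <= b -> x != c -> 0 < W x].
Proof.
move=> /andP[ac cb] ch hs.
have [W0 W0'] := antiderivative_itv _ _ _ (le_trans ac cb) ch.
pose W x := W0 x - W0 c.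
have dW x : a <= x <= b -> is_derive x 1 W (h x).
  move=> /W0' d; rewrite -[h x]subr0; exact: is_deriveB.
have cW : {within `[a, b], continuous W}.
  apply/subspace_continuousP => x /=; rewrite in_itv/= => /dW [d _].
  by apply: cvg_within_filter; exact/differentiable_continuous/derivable1_diffP.
have dWo x : x \in `]a, b[ -> is_derive x 1 W (h x).
  by rewrite in_itv/= => /andP[? ?]; apply: dW; lra.
have [H HW] := continuous_derivative_lipschitz _ _ _ _ dWo cW ch.
exists W, H; split => //.
- by move=> x xab; apply: is_derive_slope; exact: dW.
- by rewrite /W subrr.
move=> x /andP[ax xb] xc.
have mvt y z : a <= y -> y < z -> z <= b ->
    exists2 s, y < s < z & W z - W y = h s * (z - y).
  move=> ay yz zb.
  have d s : s \in `]y, z[ -> is_derive s 1 W (h s).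
    by rewrite in_itv/= => /andP[? ?]; apply: dW; lra.
  have c' : {within `[y, z], continuous W}.
    apply: continuous_subspaceW cW => w /=; rewrite !in_itv/= => /andP[? ?].
    lra.
  by have [s] := MVT yz d c'; rewrite in_itv/= => ys ->; exists s.
have Wc : W c = 0 by rewrite /W subrr.
have [xltc|cltx|xE] := ltgtP x c; last by rewrite xE eqxx in xc.
  have [s /andP[xs sc]] := mvt x c ax xltc cb.
  have sab : a <= s <= b by lra.
  have := hs s sab (negbT (lt_eqF sc)).
  have sc0 : s - c < 0 by rewrite subr_lt0.
  rewrite (nmulr_lgt0 _ sc0) Wc sub0r => hs0 WE.
  have : h s * (c - x) < 0 by rewrite nmulr_rlt0 // subr_gt0.
  by rewrite -WE oppr_lt0.
have [s /andP[cs sx]] := mvt c x ac cltx xb.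
have sab : a <= s <= b by lra.
have sc : 0 < s - c by rewrite subr_gt0.
have := hs s sab (negbT (gt_eqF cs)); rewrite (pmulr_lgt0 _ sc) Wc subr0.
by move=> hs0 ->; rewrite mulr_gt0// subr_gt0.
Qed.

Definition oscillator_trajectory {R : realType} (b eta : R) (a g e h : R -> R)
    (r q : R -> R) : Prop :=
  [/\ forall t, 0 <= t -> 0 <= q t <= b,
      forall T, 0 <= T -> abs_continuous 0 T r,
      forall T, 0 <= T -> abs_continuous 0 T q &
      {ae lebesgue_measure, forall t : R, 0 < t ->
         exists w, oscillator_slope eta a g e h r q t w}].

(** Interface to the model: the potential is built from [h] and no longer appears. The radius [d']
    is uniform over trajectories, as stability demands, whereas [T] may depend on the trajectory. *)
Lemma damped_oscillator_asymptotically_stable {R : realType}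
    (qs b a0 A G L eta : R) (a g e h : R -> R) :
  0 <= qs <= b -> 0 < a0 -> 0 < eta ->
  (forall x, 0 <= x <= b -> a0 <= a x <= A) ->
  (forall x, 0 <= x <= b -> 0 <= g x <= G) ->
  (forall x y, 0 <= x <= b -> 0 <= y <= b -> x <= y -> e x <= e y) ->
  (forall x y, 0 <= x <= b -> 0 <= y <= b -> `|e y - e x| <= L * `|y - x|) ->
  {within `[0, b], continuous h} ->
  (forall x, 0 <= x <= b -> x != qs -> 0 < h x * (x - qs)) ->
  (forall d, 0 < d -> exists2 d', 0 < d' & forall r q,
     oscillator_trajectory b eta a g e h r q ->
     `|r 0 - e qs| < d' -> `|q 0 - qs| < d' ->
     forall t, 0 <= t -> `|r t - e qs| < d /\ `|q t - qs| < d) /\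
  (forall r q, oscillator_trajectory b eta a g e h r q ->
     forall d, 0 < d -> exists2 T, 0 <= T &
       forall t, T <= t -> `|r t - e qs| < d /\ `|q t - qs| < d).
Proof.
move=> qsb a00 eta0 ab gb em el ch hs.
have [W [H [Ws Wl Wqs W0]]] := potential _ _ _ _ qsb ch hs.
split=> [d d0|r q [qb rac qac dyn] d d0]; last first.
  exact: (trajectory_cvg _ _ _ _ _ _ _ _ _ _ _ _ _ qsb a00 eta0 ab gb em el
    Wl Ws Wqs W0 ch hs _ _ qb rac qac dyn).
have [m m0 hm] := energy_lt_near _ _ _ _ _ _ qsb el Wl Wqs W0 _ d0.
have [d' d'0 hd] := energy_small _ _ _ _ _ _ qsb el Wl Wqs _ m0.
exists d' => // r q [qb rac qac dyn] r0 q0 t t0; apply: hm; first exact: qb.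
apply: le_lt_trans (hd _ _ (qb _ (lexx 0)) r0 q0).
exact: (energy_nonincreasing _ _ _ _ _ _ _ _ _ _ _ _ a00 eta0 ab gb em el
  Wl Ws _ _ qb rac qac dyn).
Qed.

(** * Reduction of the modified system to the oscillator *)

Section modified_system.
Context {R : realType} (KR mus qad : R) (f p mu alpha : R -> R).
Let F := modified_field KR mus qad f p mu alpha.
Let g q := f (p q).
Let e := eta1 mu alpha.
Let h q := ((g q + alpha q) * e q - KR) / alpha q.

Lemma caratheodory_coordinates (D : set (R * R)) (phi : R -> R * R) (T : R) :
  caratheodory_solution D F phi -> 0 <= T ->
  abs_continuous 0 T (fun t => (phi t).1) /\
  abs_continuous 0 T (fun t => (phi t).2).
Proof.
move=> [_ ac _] T0; have acT := ac T T0.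
by split; apply: (abs_continuous_lipschitz 0 T 1 phi) => // x y _ _ _;
  rewrite mul1r prod_normE le_max lexx ?orbT.
Qed.

(** From [qad] on, admission is capped at [mus], which is the service rate there, so [q] cannot
    increase. *)
Lemma modified_upper_barrier (phi : R -> R * R) :
  (forall q, qad <= q -> mu q = mus) ->
  caratheodory_solution field_domain F phi ->
  (phi 0).2 <= qad -> forall t, 0 <= t -> (phi t).2 <= qad.
Proof.
move=> muq sol; have [_ _ dyn] := sol.
apply: (upper_barrier qad (fun t => (phi t).2)) => [T T0|].
  by have [] := caratheodory_coordinates _ _ _ sol T0.
apply: ae_lebesgueS dyn => t ht t0.
have [_ s2] := is_derive_pair_slope _ _ _ (ht t0).
exists (F (phi t)).2 => // qt; rewrite /F /modified_field.
case: (phi t) qt => r q /= qq; rewrite /alpha_ad ltNge qq/= muq// subr_le0.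
by rewrite ge_min lexx orbT.
Qed.

Lemma modified_oscillator_trajectory (eta : R) (phi : R -> R * R) :
  (forall q, qad <= q -> mu q = mus) ->
  (forall q, 0 <= q <= qad -> 0 < alpha q) -> eta <= h qad ->
  caratheodory_solution field_domain F phi -> (phi 0).2 <= qad ->
  oscillator_trajectory qad eta alpha g e h
    (fun t => (phi t).1) (fun t => (phi t).2).
Proof.
move=> muq a0 etah sol q0; have [dom _ dyn] := sol.
have qb t : 0 <= t -> 0 <= (phi t).2 <= qad.
  by move=> t0; rewrite dom//= (modified_upper_barrier _ muq sol q0).
split => //.
- by move=> T T0; have [] := caratheodory_coordinates _ _ _ sol T0.
- by move=> T T0; have [] := caratheodory_coordinates _ _ _ sol T0.
apply: ae_lebesgueS dyn => t ht t0.
have [s1 s2] := is_derive_pair_slope _ _ _ (ht t0).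
have qt := qb _ (ltW t0); have at0 := a0 _ qt.
have an0 := lt0r_neq0 at0.
set r := (phi t).1; set q := (phi t).2 in qt at0 an0 *.
have FE : F (phi t) = (KR - g q * r - alpha_ad mus qad alpha r q,
    alpha_ad mus qad alpha r q - mu q).
  by rewrite /F /modified_field /r /q; case: (phi t).
rewrite FE /= in s1 s2.
(* This [w] is forced by the equation for [q]. Since [mu = alpha * e], it is [v] wherever the cap is
   inactive; at [qad] with the cap active, admission equals service, so [w = 0], and there
   [v > 0]. *)
exists ((alpha_ad mus qad alpha r q - mu q) / alpha q); split.
- congr (slope _ _ _) : s1.
  by rewrite -/r -/q /h /e /eta1; field.
- by congr (slope _ _ _) : s2; rewrite -/q mulrC divfK.
rewrite /= -/r -/q; case/andP: qt => _.
rewrite le_eqVlt /alpha_ad => /predU1P[qE|->].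
  have -> : (q < qad) = false by rewrite qE ltxx.
  have muE : mu q = mus by rewrite qE muq.
  rewrite /e /eta1 muE; case: (leP (alpha q * r) mus) => am.
    by left; field.
  right; split; first by rewrite subrr mul0r.
    by rewrite subr_ge0 ler_pdivrMr// mulrC ltW.
  by rewrite qE.
by left; rewrite /e /eta1; field.
Qed.

End modified_system.

Lemma cvg_pairP {R : realType} (phi : R -> R * R) (x : R * R) :
  (forall d, 0 < d -> exists2 T, 0 <= T & forall t, T <= t ->
     `|(phi t).1 - x.1| < d /\ `|(phi t).2 - x.2| < d) ->
  phi t @[t --> +oo] --> x.
Proof.
move=> h; apply/cvgrPdist_lt => d d0; have [T _ hT] := h d d0.
exists T; split; first exact: num_real.
move=> t /ltW /hT[h1 h2]; rewrite distrC prod_normE gt_max.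
by rewrite h1 h2.
Qed.

Theorem theorem3p5 (R : realType)
    (KR mus qc beta qm qmax : R)
    (KR_gt0 : 0 < KR) (mus_gt0 : 0 < mus) (qc_gt0 : 0 < qc)
    (beta_gt0 : 0 < beta) (qm_gt0 : 0 < qm) (qmax_gt0 : 0 < qmax)
    (mus_lt_KR : mus < KR) (qmax_ge : 2 * qm <= qmax)
    (f df : R -> R)
    (f_ge0 : forall x : R, 0 <= x -> 0 <= f x)
    (f_C1 : C1_Rplus f df)
    (df_gt0 : forall x : R, 0 <= x -> 0 < df x)
    (alpha dalpha : R -> R)
    (alpha_C1 : C1_Rplus alpha dalpha)
    (alpha_gt0 : forall q : R, 0 <= q -> q < qmax -> 0 < alpha q)
    (alpha_decr : forall q q' : R, 0 <= q -> q < q' -> q' < qmax ->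
       alpha q' < alpha q)
    (alpha_eq0 : forall q : R, qmax <= q -> alpha q = 0) :
  let p := price beta qm in
  let mu := service mus qc in
  let e1 := eta1 mu alpha in
  let e2 := eta2 KR f p alpha in
  forall (qs qu : R)
    (eta_sol : forall q : R,
       (0 < q /\ q < qmax /\ e1 q = e2 q) <-> (q = qs \/ q = qu))
    (qs_range : 0 < qs /\ qs < qm)
    (qu_range : qm < qu /\ qu < 2 * qm)
    (deta_qu : derive1 e1 qu < derive1 e2 qu)
    (mu_qs : mu qs = mus) (mu_qu : mu qu = mus)
    (Rdag : R)
    (Rdag_attained : exists q : R, [/\ 0 <= q, q <= qm & e2 q = Rdag])
    (Rdag_ub : forall q : R, 0 <= q -> q <= qm -> e2 q <= Rdag)
    (qdag : R)
    (qdag_range : 0 <= qdag /\ qdag < qmax)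
    (qdag_def : e1 qdag = Rdag)
    (qad : R),
  let Rs := e1 qs in
  let Ru := e1 qu in
  let xs := (Rs, qs) in
  let F := modified_field KR mus qad f p mu alpha in
  Rdag < Ru ->
  qdag < qad -> qad < qu ->
  locally_asymptotically_stable_fixed_point field_domain F xs /\
  (forall x : R * R, X_ad qad x ->
   forall phi : R -> R * R,
     caratheodory_solution field_domain F phi -> phi 0 = x ->
     phi t @[t --> +oo] --> xs).
Proof.
move=> p mu e1 e2 qs qu eta_sol [qs0 qsqm] [qmqu qu2] deta mu_qs mu_qu Rdag _.
move=> Rdag_ub qdag [qdag0 qdagm] qdagE qad Rs Ru xs F _ qdq qadqu.
have quqmax : qu < qmax by exact: lt_le_trans qmax_ge.
have qu0 : 0 < qu by lra.
have p_ge0 (q : R) : 0 <= q -> 0 <= p q by exact: price_ge0.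
have den_gt0 (q : R) : 0 <= q -> q < qmax -> 0 < alpha q + f (p q).
  by move=> q0 qq; rewrite ltr_wpDr ?alpha_gt0 ?f_ge0 ?p_ge0.
have a_anti (x y : R) : 0 <= x -> x <= y -> y < qmax -> alpha y <= alpha x.
  move=> x0; rewrite le_eqVlt => /predU1P[-> _|xy yq]; first exact: lexx.
  by rewrite ltW// alpha_decr.
have mu_sat q : qs <= q -> mu q = mus by exact: service_sat.
have [_ [_ e12s]] : 0 < qs /\ qs < qmax /\ e1 qs = e2 qs.
  by apply/eta_sol; left.
have [_ [_ e12u]] : 0 < qu /\ qu < qmax /\ e1 qu = e2 qu.
  by apply/eta_sol; right.
(* If [qdag < qs], then [e1 qdag < e1 qs = e2 qs <= Rdag = e1 qdag]; strictness comes from the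
   decrease of [alpha], as [mu] is at most its value [mus] at [qs]. *)
have qsdag : qs <= qdag.
  rewrite leNgt; apply/negP => lt_s.
  have : e2 qs <= Rdag by apply: Rdag_ub; exact: ltW.
  rewrite -e12s -qdagE leNgt => /negP; apply.
  have qsqmax : qs < qmax by lra.
  have as0 : 0 < alpha qs by apply: alpha_gt0; [exact: ltW|].
  have ad0 : 0 < alpha qdag by exact: alpha_gt0.
  apply: le_lt_trans (_ : _ <= mus / alpha qdag) _.
    by rewrite ler_pM2r ?invr_gt0// service_le.
  by rewrite /e1 /eta1 mu_qs ltr_pM2l// ltf_pV2 ?posrE// alpha_decr.
have qsqad : qs < qad := le_lt_trans qsdag qdq.
have qad0 : 0 < qad := lt_trans qs0 qsqad.
have qadmax : qad < qmax := lt_trans qadqu quqmax.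
have [f' _] := f_C1; have [a' ca'] := alpha_C1.
have onRplus c (u : R -> R) : {within `[0, +oo[, continuous u} ->
    {within `[0, c], continuous u}.
  apply: continuous_subspaceW => x /=; rewrite !in_itv/= => /andP[->].
  by [].
have ca c := onRplus c _ (derivative_Rplus_continuous _ _ a').
have cfp c := onRplus c _ (comp_price_continuous _ _ _ _ beta_gt0 qm_gt0 f_C1).
have da (q : R) : 0 < q -> is_derive q 1 alpha (dalpha q).
  exact: derivative_Rplus_is_derive.
have [La aLip] : exists L, forall x y : R, 0 <= x <= qu -> 0 <= y <= qu ->
    `|alpha y - alpha x| <= L * `|y - x|.
  apply: continuous_derivative_lipschitz (ca qu) (onRplus qu _ ca') => x.
  by rewrite in_itv/= => /andP[x0 _]; exact: da.
have au0 : 0 < alpha qu by apply: alpha_gt0 => //; exact: ltW.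
have au (x : R) : 0 <= x <= qu -> alpha qu <= alpha x.
  by move=> /andP[? ?]; exact: a_anti.
have mu0 (q : R) : 0 <= q -> 0 <= mu q by exact: service_ge0.
have muM (x : R) : 0 <= x <= qu -> `|mu x| <= mus.
  by move=> /andP[x0 _]; rewrite ger0_norm ?mu0// service_le.
have e1Lip := ratio_lipschitz _ _ _ _ _ _ _ _ au0 au muM
  (fun x y _ _ => service_lipschitz mus qc x y mus_gt0 qc_gt0) aLip.
set L := _ + _ in e1Lip.
have ce1 : {within `[0, qu], continuous e1}.
  apply: abs_continuous_within.
  apply: (abs_continuous_lipschitz 0 qu L id); first exact: abs_continuous_id.
  by move=> x y x0 xy yq; apply: e1Lip; lra.
(* The numerator of [h]; by [kE] it is a positive multiple of [e1 - e2], so [eta_sol] locates its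
   zeros. *)
pose k q := (f (p q) + alpha q) * e1 q - KR.
have kE (q : R) : 0 <= q -> q < qmax ->
    k q = (alpha q + f (p q)) * (e1 q - e2 q).
  by move=> q0 qq; rewrite /k /e2 /eta2; field; rewrite gt_eqF ?den_gt0.
have ck : {within `[0, qu], continuous k}.
  move=> x; apply: cvgB; last exact: cvg_cst.
  by apply: cvgM; [apply: cvgD; [exact: cfp|exact: ca]|exact: ce1].
have k_left (x : R) : x < qu -> exists2 z, x < z < qu & 0 < k z.
  move=> xqu.
  have qunz : alpha qu != 0 by rewrite gt_eqF.
  have near_above (c : R) : c < qu -> \forall q \near qu, c < q.
    by move=> cq; exact: lt_nbhsr.
  (* The slope inequality at [qu] is usable only once both functions are known to be derivable
     there. The corners of [mu] and [p] do not interfere: near [qu] the service rate is constant, as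
     [qs < qu], and the price is affine, as [qm < qu < 2 * qm]. *)
  have d1 : derivable e1 qu 1.
    have dd : derivable (fun q => mus * (alpha q)^-1) qu 1.
      apply: derivableM; first exact: derivable_cst.
      by apply: derivableV => //; have [] := da _ qu0.
    apply: near_eq_derivable dd; apply: filterS (near_above qs _); last by lra.
    by move=> q /ltW qsq; rewrite /e1 /eta1 mu_sat.
  pose P q := beta * (2 * qm - q).
  have dfp : derivable (f \o P) qu 1.
    have P0 : 0 < P qu by rewrite mulr_gt0//; lra.
    have df0 := derivative_Rplus_is_derive _ _ _ f' P0.
    have dP : is_derive qu 1 P (- beta).
      apply: slope_is_derive => d d0; apply: filterE => q.
      rewrite (_ : _ - _ - _ = 0); last by rewrite /P; ring.
      by rewrite normr0 mulr_ge0// ltW.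
    by have [] := is_derive1_comp df0 dP.
  have d2 : derivable e2 qu 1.
    have pE q : qm < q -> q <= 2 * qm -> p q = P q.
      by move=> q1 q2; rewrite /p /price leNgt q1/= q2.
    have dd : derivable (fun q => KR * (alpha q + (f \o P) q)^-1) qu 1.
      apply: derivableM; first exact: derivable_cst.
      apply: derivableV.
        by rewrite /= -pE ?(ltW qu2)// gt_eqF// den_gt0// ltW.
      by apply: derivableD => //; have [] := da _ qu0.
    apply: near_eq_derivable dd.
    apply: filterS2 (near_above qm qmqu) (lt_nbhsl qu2).
    by move=> q q1 /ltW q2; rewrite /e2 /eta2 pE.
  have s12 : slope (fun q => e1 q - e2 q) qu (derive1 e1 qu - derive1 e2 qu).
    rewrite !derive1E; apply: is_derive_slope.
    exact: (@is_deriveB _ _ _ _ _ _ _ _ _ (derivableP d1) (derivableP d2)).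
  have e12_0 : e1 qu - e2 qu = 0 by rewrite e12u subrr.
  have de_lt0 : derive1 e1 qu - derive1 e2 qu < 0 by rewrite subr_lt0.
  (* The maximum keeps [z] positive, inside the range where [kE] applies. *)
  have m_lt : Num.max 0 x < qu by rewrite gt_max qu0.
  have [z /andP[mz zu] ez] := gt0_left_of_zero _ _ _ s12 e12_0 de_lt0 _ m_lt.
  move: mz; rewrite gt_max => /andP[z0 xz].
  exists z; first by rewrite xz.
  rewrite kE ?(ltW z0) ?(lt_trans zu)//; apply: mulr_gt0 => //.
  by apply: den_gt0; [exact: ltW|exact: lt_trans zu _].
have k_sign : forall x : R, 0 <= x < qu -> x != qs -> 0 < k x * (x - qs).
  apply: crossing_sign => //.
  - have mu00 : mu 0 = 0 by rewrite /mu serviceE// min_l ?mulr0// ltW.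
    rewrite /k /e1 /eta1 mu00 mul0r mulr0 sub0r.
    by rewrite oppr_lt0.
  - move=> x /andP[x0 xu] kx.
    have xq : x < qmax := lt_trans xu quqmax.
    have : e1 x = e2 x.
      move: kx; rewrite kE ?(ltW x0)// => /eqP.
      by rewrite mulf_eq0 gt_eqF ?den_gt0 ?(ltW x0)//= subr_eq0 => /eqP.
    move=> e12; have [->//|xE] : x = qs \/ x = qu by apply/eta_sol.
    by move: xu; rewrite xE ltxx.
pose h q := k q / alpha q.
have qad_qu (x : R) : 0 <= x <= qad -> 0 <= x <= qu by move=> /andP[? ?]; lra.
have a_gt0 (x : R) : 0 <= x <= qad -> 0 < alpha x.
  by move=> /qad_qu/au; exact: lt_le_trans.
have h_sign (x : R) : 0 <= x <= qad -> x != qs -> 0 < h x * (x - qs).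
  move=> xq xs'; rewrite /h mulrAC divr_gt0 ?a_gt0// k_sign//.
  by case/andP: xq => -> xq; rewrite (le_lt_trans xq).
(* Sliding happens only at [qad], so [h qad] serves as the lower bound [eta] on the restoring force
   during sliding. *)
have eta0 : 0 < h qad.
  have qq : 0 <= qad <= qad by rewrite lexx ltW.
  have := h_sign _ qq (negbT (gt_eqF qsqad)).
  by rewrite pmulr_lgt0// subr_gt0.
have ch : {within `[0, qad], continuous h}.
  apply/subspace_continuousP => x xq.
  have xA : `[0, qu]%classic x.
    by move: xq => /=; rewrite !in_itv/=; exact: qad_qu.
  have sub : `[0, qad]%classic `<=` `[0, qu]%classic.
    by move=> y; rewrite /= !in_itv/=; exact: qad_qu.
  have /subspace_continuousP /(_ x xq) ckx := continuous_subspaceW sub ck.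
  have /subspace_continuousP /(_ x xq) cax := ca qad.
  apply: cvgM ckx _; apply: cvgV cax.
  by rewrite gt_eqF// a_gt0//; move: xq; rewrite /= in_itv.
have [G hG] : exists G, forall x, 0 <= x <= qad -> 0 <= f (p x) <= G.
  have [c _ hc] := EVT_max (ltW qad0) (cfp qad).
  exists (f (p c)) => x xq; apply/andP; split.
    by apply: f_ge0; apply: p_ge0; case/andP: xq.
  by apply: hc; rewrite in_itv.
have a_bound (x : R) : 0 <= x <= qad -> alpha qad <= alpha x <= alpha 0.
  move=> /andP[x0 xq]; rewrite !a_anti//; exact: le_lt_trans qadmax.
have e1_mono (x y : R) : 0 <= x <= qad -> 0 <= y <= qad ->
    x <= y -> e1 x <= e1 y.
  move=> xq yq xy; have [x0 _] := andP xq; have [y0 yq'] := andP yq.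
  apply: ler_pM; rewrite ?mu0 ?invr_ge0 ?(ltW (a_gt0 _ xq))//.
    exact: service_mono.
  by rewrite lef_pV2 ?posrE ?a_gt0// a_anti// (le_lt_trans yq').
have aqad : 0 < alpha qad by apply: a_gt0; rewrite lexx ltW.
have qs_in : 0 <= qs <= qad by lra.
have [stab conv] := damped_oscillator_asymptotically_stable
  _ _ _ _ _ _ _ _ _ _ _ qs_in aqad eta0 a_bound hG e1_mono
  (fun x y xq yq => e1Lip x y (qad_qu x xq) (qad_qu y yq)) ch h_sign.
have mu_sat' q : qad <= q -> mu q = mus.
  by move=> qq; apply: mu_sat; exact: le_trans (ltW qsqad) qq.
have traj phi : caratheodory_solution field_domain F phi -> (phi 0).2 <= qad ->
    oscillator_trajectory qad (h qad) alpha (fun q => f (p q)) e1 h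
      (fun t => (phi t).1) (fun t => (phi t).2).
  by move=> sol q0; apply: (modified_oscillator_trajectory KR mus qad f p mu).
have conv' phi : caratheodory_solution field_domain F phi -> (phi 0).2 <= qad ->
    phi t @[t --> +oo] --> xs.
  by move=> sol q0; apply: cvg_pairP; exact: conv (traj _ sol q0).
(* Starting within [qad - qs] of the fixed point forces the initial [q] to be at most [qad], where
   the oscillator form is available; this limits the radii for both stability and attraction. *)
have close (phi : R -> R * R) (d : R) : `|phi 0 - xs| < d -> d <= qad - qs ->
    [/\ `|(phi 0).1 - Rs| < d, `|(phi 0).2 - qs| < d & (phi 0).2 <= qad].
  rewrite prod_normE gt_max /= => /andP[h1 h2] dq; split => //.
  by have := le_lt_trans (ler_norm _) h2; lra.
split; last first.
  by move=> x [_ /andP[_ xq]] phi sol phi0; apply: conv'; rewrite ?phi0.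
have dq0 : 0 < qad - qs by rewrite subr_gt0.
split.
- split; first exact: ltW.
  have as0 := a_gt0 _ qs_in.
  have qsqmax : qs < qmax := lt_trans qsqad qadmax.
  have d0 := den_gt0 _ (ltW qs0) qsqmax.
  rewrite /F /modified_field /xs /alpha_ad qsqad; congr (_, _).
    rewrite /Rs e12s /e2 /eta2; field; exact: lt0r_neq0.
  by rewrite /Rs /e1 /eta1; field; exact: lt0r_neq0.
- move=> d d0; have [d' d'0 hd] := stab d d0.
  exists (Num.min d' (qad - qs)); first by rewrite lt_min d'0.
  move=> phi sol phi0 t t0.
  have dq : Num.min d' (qad - qs) <= qad - qs by rewrite ge_min lexx orbT.
  have [h1 h2 h3] := close _ _ phi0 dq.
  have r0 : `|(phi 0).1 - Rs| < d'.
    by apply: lt_le_trans h1 _; rewrite ge_min lexx.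
  have q0 : `|(phi 0).2 - qs| < d'.
    by apply: lt_le_trans h2 _; rewrite ge_min lexx.
  have [r1 q1] := hd _ _ (traj _ sol h3) r0 q0 t t0.
  by rewrite prod_normE gt_max /= r1 q1.
- exists (qad - qs) => // phi sol phi0; apply: conv' => //.
  by have [] := close _ _ phi0 (lexx _).
Qed.
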